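(* Let $\theta,\eta\in\mathbb R$, ${}^{*}d,{}^{*}e\in{}^{*}\mathbb N$ with ${}^{*}d,{}^{*}e\ge1$, and let ${}^{*}f\in{}^{*}\tilde{\mathcal Z}(\theta)$ with $\deg{}^{*}f\le{}^{*}d$ and ${}^{*}g\in{}^{*}\tilde{\mathcal Z}(\eta)$ with $\deg{}^{*}g\le{}^{*}e$, both of positive degree. Then \[\nu_{{}^{*}d{}^{*}e}({}^{*}f\boxtimes{}^{*}g)\le\Big(\mathfrak m_{{}^{*}d}({}^{*}f)^{1-{}^{*}e^{-1}}\mathfrak m_{{}^{*}e}({}^{*}g)\cdot\nu_{{}^{*}d}({}^{*}f)^{{}^{*}e^{-1}}\Big)+\Big(\mathfrak m_{{}^{*}d}({}^{*}f)\,\mathfrak m_{{}^{*}e}({}^{*}g)^{1-{}^{*}d^{-1}}\cdot\nu_{{}^{*}e}({}^{*}g)^{{}^{*}d^{-1}}\Big),\] where the left side is the decay at $\theta\eta$, $\nu_{{}^{*}d}({}^{*}f)$ the decay at $\theta$, $\nu_{{}^{*}e}({}^{*}g)$ the decay at $\eta$, and $+$ is the maximum. In particular, for $\mu,\nu\in{}^{\star}\mathbb{PR}_{\varepsilon}$ there is a well-defined map \[{}^{*}\tilde Z^{\mu}_{(\mu^{1-{}^{*}e^{-1}}\cdot\nu)^{{}^{*}e}}(\theta)_{{}^{*}d}\times{}^{*}\tilde Z^{\nu}_{(\mu\cdot\nu^{1-{}^{*}d^{-1}})^{{}^{*}d}}(\eta)_{{}^{*}e}\xrightarrow{\ \boxtimes\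 }{}^{*}\tilde Z^{\mu\cdot\nu}(\theta\eta)_{{}^{*}d{}^{*}e}.\]
   Context: Fix a nonprincipal ultrafilter $\mathfrak u$ on $\mathbb N$; ${}^{*}S=S^{\mathbb N}/\mathfrak u$ denotes ultrapowers, elements ${}^{*}\{x_i\}$, operations componentwise; $x\simeq y$ means $x-y$ infinitesimal. $({}^{*}\mathbb R_{\rm fin})^{\times}_{+}$ is the group of positive elements of ${}^{*}\mathbb R$ neither infinite nor infinitesimal; ${}^{\star}\mathbb{PR}=({}^{*}\mathbb R_{+}\cup\{0\})/({}^{*}\mathbb R_{\rm fin})^{\times}_{+}$, ordered via representatives, with induced product and tropical sum $\mu+\nu=\max(\mu,\nu)$; $\langle x\rangle$ is the class of $|x|$; for $x\in{}^{*}\mathbb R_+$, $x\cdot\mu:=\langle x\rangle\cdot\mu$; ${}^{\star}\mathbb{PR}_{\varepsilon}$ is the set of classes of positive infinitesimals. For $\mu$ the class of ${}^{*}\{x_i\}$ and ${}^{*}r={}^{*}\{r_i\}\ge0$ bounded (possibly infinitesimal), $\mu^{{}^{*}r}$ is the class of ${}^{*}\{x_i^{r_i}\}$; similarly powers of elements of ${}^{*}\mathbb R_+$ are componentwise. ${}^{*}\tilde{\mathcal Z}={}^{*}(\mathbb Z[X])$, $\deg{}^{*}f={}^{*}\{\deg f_i\}$, ${}^{*}f(t)={}^{*}\{f_i(t)\}$; ${}^{*}\tilde{\mathcal Z}(t)=\{{}^{*}f:{}^{*}f(t)\simeq0\}$. Height $\mathfrak h$ (max absolute coefficient) and Mahler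 measure $\mathfrak m(a\prod(X-\alpha_i))=|a|\prod\max(1,|\alpha_i|)$ componentwise; $\mathfrak m_{{}^{*}d}=\mathfrak m^{1/{}^{*}d}$. For $\deg{}^{*}f\le{}^{*}d$: growth $\mu_{{}^{*}d}({}^{*}f)=\langle\mathfrak h({}^{*}f)^{-1/{}^{*}d}\rangle$, decay at $t$: $\nu_{{}^{*}d}({}^{*}f)=\langle|{}^{*}f(t)|^{1/{}^{*}d}\rangle$. ${}^{*}\tilde Z^{\mu}(t)_{{}^{*}d}=\{{}^{*}f\in{}^{*}\tilde{\mathcal Z}(t):\deg{}^{*}f\le{}^{*}d,\ \mu_{{}^{*}d}({}^{*}f)>\mu\}$. For $\lambda\in{}^{\star}\mathbb{PR}_\varepsilon$ and ${}^{*}e\in{}^{*}\mathbb N$ (possibly infinite), ${}^{*}\tilde Z^{\mu}_{\lambda^{{}^{*}e}}(t)_{{}^{*}d}=\{{}^{*}f\in{}^{*}\tilde Z^{\mu}(t)_{{}^{*}d}:\nu_{{}^{*}d}({}^{*}f)^{1/{}^{*}e}\le\lambda\}$; this is used with $\lambda=\mu^{1-{}^{*}e^{-1}}\cdot\nu$ and $\lambda=\mu\cdot\nu^{1-{}^{*}d^{-1}}$ (exponent ${}^{*}d$). Resultant product: for $f=a_m\prod_{i=1}^m(X-\alpha_i)$, $g=b_n\prod_{j=1}^n(X-\beta_j)$ of degrees $m,n\ge1$, $f\boxtimes g=a_m^nb_n^m\prod_{i,j}(X-\alpha_i\beta_j)\in\mathbb Z[X]$ of degree $mn$, extended componentwise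 to ${}^{*}(\mathbb Z[X])$. *)

(* Defs.v *)
From HB Require Import structures.
From mathcomp Require Import all_boot all_order all_algebra.
From mathcomp Require Import generic_quotient complex.
From mathcomp Require Import all_classical all_reals.
From mathcomp Require Import topology normedtype sequences exp.

Set Implicit Arguments.
Unset Strict Implicit.
Unset Printing Implicit Defensive.

Import Order.TTheory GRing.Theory Num.Theory.
Local Open Scope classical_set_scope.
Local Open Scope ring_scope.
Local Open Scope quotient_scope.
Section ProdValues.
Variable L : comNzRingType.
Implicit Types (s : seq L) (q : {poly L}).

Let newton s k : {poly L} := \prod_(j < k) ('X - (s`_j)%:P).

Let newtonS s k : newton s k.+1 = newton s k * ('X - (s`_k)%:P).
Proof. by rewrite /newton big_ord_recr. Qed.

Let newton_monic s k : newton s k \is monic.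
Proof. by apply: monic_prod => j _; exact: monicXsubC. Qed.

Let size_newton s k : size (newton s k) = k.+1.
Proof. by rewrite /newton size_prod_XsubC -[index_enum _]enumT size_enum_ord. Qed.

Let newton_coef s k : (newton s k)`_k = 1.
Proof. by have /monicP := newton_monic s k; rewrite /lead_coef size_newton. Qed.

Let newton_lt s k l : (k < l)%N -> (newton s k)`_l = 0.
Proof. by move=> kl; rewrite nth_default // size_newton. Qed.

Let newton_roots s : newton s (size s) = \prod_(z <- s) ('X - z%:P).
Proof. by rewrite (big_nth 0) big_mkord. Qed.

Let newtonD s k : newton s (size s + k) = newton s (size s) * 'X^k.
Proof.
elim: k => [|k IH]; first by rewrite addn0 mulr1.
rewrite addnS newtonS IH nth_default ?leq_addr // subr0.
by rewrite -mulrA -exprSr.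
Qed.

Let newton_expand s N k q : (size q <= N - k)%N -> exists c : nat -> L,
  [/\ newton s k * q = \sum_(l < N) c l *: newton s l,
      forall l, (l < k)%N -> c l = 0 & (k < N)%N -> c k = q.[s`_k]].
Proof.
move Er: (N - k)%N => r; elim: r k Er q => [|r IH] k Ek q sq.
  exists (fun=> 0); split=> // [|kN].
    move: sq; rewrite leqn0 size_poly_eq0 => /eqP->.
    by rewrite mulr0 big1 // => l _; rewrite scale0r.
  by move: Ek => /eqP; rewrite subn_eq0 leqNgt kN.
have kN : (k < N)%N by rewrite -subn_gt0 Ek.
have /factor_theorem[q' Eq] : root (q - (q.[s`_k])%:P) s`_k.
  by rewrite rootE !hornerE subrr.
have sq' : (size q' <= r)%N.
  have [->|nz] := eqVneq q' 0; first by rewrite size_poly0.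
  have := size_Mmonic nz (monicXsubC s`_k); rewrite -Eq size_XsubC addn2 /=.
  rewrite -ltnS => <-; apply: (leq_trans (size_polyD _ _)).
  rewrite geq_max sq size_polyN (leq_trans (size_polyC_leq1 _)) //.
have Ek1 : (N - k.+1)%N = r by rewrite subnS Ek.
have [c [Ec c0 _]] := IH k.+1 Ek1 q' sq'.
exists (fun l => if l == k then q.[s`_k] else c l); split; last 2 first.
- by move=> l lk; rewrite ltn_eqF // c0 // ltnW.
- by rewrite eqxx.
rewrite (bigD1 (Ordinal kN)) //= eqxx.
rewrite -[q in LHS](subrK (q.[s`_k])%:P) Eq mulrDr [_ * _%:P]mulrC mul_polyC addrC.
congr (_ + _); rewrite [q' * _]mulrC mulrA -newtonS Ec (bigD1 (Ordinal kN)) //=.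
rewrite c0 // scale0r add0r; apply: eq_bigr => l /negPf; rewrite -val_eqE /= => ->.
by [].
Qed.

(* b ^+ m * \prod h(z) over the roots z of g is the determinant of the Sylvester
   matrix of g and h, h having formal degree m. *)
Lemma prod_values_det (A : comNzRingType) (io : {rmorphism A -> L})
    (g h : {poly A}) (b : L) s m :
  map_poly io g = b *: \prod_(z <- s) ('X - z%:P) -> (size h <= m.+1)%N ->
  exists c : A, io c = b ^+ m * \prod_(z <- s) (map_poly io h).[z].
Proof.
move=> Eg sh; pose n := size s; pose N := (n + m)%N.
pose hL := map_poly io h.
pose S (k : nat) : {poly A} := if (k < n)%N then 'X^k * h else 'X^(k - n) * g.
pose M : 'M[A]_N := \matrix_(k, l) (S k)`_l.
exists (\det M); rewrite -det_map_mx.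
have /fin_all_exists[c Hc] (k : 'I_N) : exists c : nat -> L, (k < n)%N ->
  [/\ newton s k * hL = \sum_(l < N) c l *: newton s l,
      forall l, (l < k)%N -> c l = 0 & c k = hL.[s`_k]].
  have [kn|] := boolP (k < n)%N; last by exists (fun=> 0).
  have [|c [E1 E2 E3]] := @newton_expand s N k hL; last by exists c; split=> //; exact: E3.
  apply: (leq_trans (size_poly _ _)); apply: (leq_trans sh).
  by rewrite ltn_subRL {2}/N ltn_add2r.
pose W : 'M[L]_N := \matrix_(k, l) if (k < n)%N then (newton s k)`_l else (k == l)%:R.
pose V : 'M[L]_N := \matrix_(k, l) if (k < n)%N then c k l else b * (k == l)%:R.
pose T : 'M[L]_N := \matrix_(k, l) (newton s k)`_l.
have dW : \det W = 1.
  rewrite det_trig ?big1 // => [k _|].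
    by rewrite mxE newton_coef eqxx if_same.
  apply/is_trig_mxP => k l kl; rewrite mxE newton_lt //.
  by rewrite -val_eqE ltn_eqF // if_same.
have dT : \det T = 1.
  rewrite det_trig ?big1 // => [k _|]; first by rewrite mxE newton_coef.
  by apply/is_trig_mxP => k l kl; rewrite mxE newton_lt.
have dV : \det V = b ^+ m * \prod_(z <- s) hL.[z].
  rewrite -det_tr det_trig; last first.
    apply/is_trig_mxP => k l kl; rewrite !mxE; case: ifP => [ln|_].
      by have [_ c0 _] := Hc l ln; exact: c0.
    by rewrite -val_eqE gtn_eqF // mulr0.
  rewrite big_split_ord /= mulrC; congr (_ * _).
    rewrite -[m in RHS]card_ord -prodr_const; apply: eq_bigr => k _.
    by rewrite !mxE /= ltnNge leq_addr eqxx mulr1.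
  rewrite (big_nth 0) big_mkord; apply: eq_bigr => k _.
  by rewrite !mxE /= ltn_ord; have [_ _ ->] := Hc (lshift m k) (ltn_ord k).
suff: W *m map_mx io M = V *m T.
  by move/(congr1 determinant); rewrite !det_mulmx dW dT dV mul1r mulr1.
apply/matrixP => k j; rewrite !mxE.
under eq_bigr do rewrite !mxE; under [RHS]eq_bigr do rewrite !mxE.
have [kn|nk] := ltnP k n; last first.
  rewrite (bigD1 k) //= eqxx mul1r [X in _ + X]big1 ?addr0; last first.
    by move=> l /negPf; rewrite eq_sym => ->; rewrite mulr0n mul0r.
  rewrite (bigD1 k) //= eqxx mulr1 [X in _ + X]big1 ?addr0; last first.
    by move=> l /negPf; rewrite eq_sym => ->; rewrite mulr0n mulr0 mul0r.
  rewrite /S ltnNge nk /= -coef_map rmorphM /= map_polyXn Eg -newton_roots.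
  by rewrite -scalerAr coefZ; have := newtonD s (k - n); rewrite subnKC // mulrC => ->.
have [E _ _] := Hc k kn.
transitivity ((newton s k * hL)`_j); last first.
  by rewrite E coef_sum; apply: eq_bigr => l _; rewrite coefZ.
have En : newton s k = \sum_(l < N) (newton s k)`_l *: 'X^l.
  by rewrite -poly_def -[LHS]coefK size_newton; apply/polyP => i;
  rewrite !coef_poly ltnS; case: leqP => ik; case: ltnP => // iN;
  rewrite ?newton_lt // ?(leq_trans (ltn_ord k)) //; 
  have := leq_ltn_trans ik (ltn_ord k); rewrite ltnNge iN.
rewrite [in RHS]En mulr_suml coef_sum; apply: eq_bigr => l _.
rewrite -scalerAl coefZ; have [ln|nl] := ltnP l n; last first.
  by rewrite newton_lt ?mul0r //; exact: leq_trans kn nl.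
by congr (_ * _); rewrite -coef_map /S ln rmorphM /= map_polyXn.
Qed.
End ProdValues.

Lemma homogenize_prod (K : comNzRingType) (s : seq K) (x y : {poly K})
   (p := \prod_(z <- s) ('X - z%:P)) :
  \sum_(k < (size s).+1) p`_k *: (x ^+ k * y ^+ (size s - k)) =
  \prod_(z <- s) (x - z *: y).
Proof.
rewrite {}/p; elim: s => [|z s IH]; rewrite ?big_cons.
  by rewrite big_ord_recl !big_ord0 !big_nil coef1 scale1r mulr1 addr0.
set p := \prod_(w <- s) _ in IH *.
have p0 : p`_(size s).+1 = 0 by rewrite nth_default // size_prod_XsubC.
rewrite -IH [RHS]mulrBl.
under eq_bigr do rewrite mulrBl coefB coefCM scalerBl mulrC coefMX.
rewrite sumrB; congr (_ - _).
  rewrite big_ord_recl /= scale0r add0r mulr_sumr; apply: eq_bigr => k _.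
  by rewrite /= subSS -scalerAr mulrA -exprS.
rewrite big_ord_recr /= p0 mulr0 scale0r addr0 mulr_sumr; apply: eq_bigr => k _.
rewrite -scalerAr -scalerAl scalerA [_ * z]mulrC; congr (_ *: _).
by rewrite mulrCA -exprS subSn // -ltnS.
Qed.

Lemma box_integral (K : comNzRingType) (f g : {poly int}) (a b : K) (s t : seq K) :
  map_poly intr f = a *: \prod_(x <- s) ('X - x%:P) ->
  map_poly intr g = b *: \prod_(y <- t) ('X - y%:P) ->
  exists h : {poly int}, map_poly intr h =
    (a ^+ size t * b ^+ size s) *: \prod_(x <- s) \prod_(y <- t) ('X - (x * y)%:P).
Proof.
move=> Ef Eg; pose io := (map_poly intr : {rmorphism {poly int} -> {poly K}}).
pose m := size s.
pose F : {poly {poly int}} := \poly_(i < m.+1) (f`_(m - i) *: 'X^(m - i)).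
have Eg' : map_poly io (map_poly polyC g) =
    b%:P *: \prod_(y <- map polyC t) ('X - y%:P).
  rewrite -map_poly_comp /=.
  transitivity (map_poly polyC (map_poly intr g : {poly K})).
    rewrite -map_poly_comp; apply: eq_map_poly => z /=.
    by rewrite map_polyC.
  rewrite Eg map_polyZ rmorph_prod big_map; congr (_ *: _).
  by apply: eq_bigr => y _; rewrite rmorphB /= map_polyX map_polyC.
have [h Eh] := prod_values_det Eg' (size_poly m.+1 _ : (size F <= m.+1)%N).
have EF y : (map_poly io F).[y%:P] = a *: \prod_(x <- s) ('X - (x * y)%:P).
  transitivity (a *: \prod_(x <- s) ('X - x *: y%:P)); last first.
    by congr (_ *: _); apply: eq_bigr => x _; rewrite -mul_polyC -polyCM.
  rewrite -homogenize_prod scaler_sumr (@horner_coef_wide _ m.+1); last first.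
    by rewrite (leq_trans (size_poly _ _)) // size_poly.
  rewrite (reindex_inj rev_ord_inj) /=; apply: eq_bigr => k _.
  rewrite subSS coef_map coef_poly /= ltnS leq_subr subKn -1?ltnS //.
  have -> : io (f`_k *: 'X^k) = (f`_k)%:~R *: 'X^k.
    by rewrite /io /= map_polyZ map_polyXn.
  have -> : (f`_k)%:~R = a * (\prod_(x <- s) ('X - x%:P))`_k.
    by rewrite -coefZ -Ef coef_map.
  by rewrite -scalerAl scalerA.
exists h; rewrite [LHS]Eh big_map exchange_big /=.
under eq_bigr do rewrite EF.
rewrite scaler_prod big_const_seq count_predT iter_mulr_1.
by rewrite -polyC_exp mul_polyC scalerA mulrC.
Qed.

Record npultra := NPUltra {
  npu : set_system nat ;
  npu_ultra : UltraFilter npu ;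
  npu_nonprincipal : forall n, npu <> principal_filter n }.
#[global] Existing Instance npu_ultra.

(* star U S is the ultrapower S^nat / U. *)
Section Ultrapower.
Variable U : npultra.

Definition ueq (S : choiceType) : rel (nat -> S) :=
  fun x y => `[< npu U [set i | x i = y i] >].

Lemma ueq_refl (S : choiceType) : reflexive (@ueq S).
Proof. by move=> x; apply/asboolP; apply: filterS filterT. Qed.

Lemma ueq_sym (S : choiceType) : symmetric (@ueq S).
Proof.
by move=> x y; apply/asboolP/asboolP; apply: filterS => i /= ->.
Qed.

Lemma ueq_trans (S : choiceType) : transitive (@ueq S).
Proof.
move=> y x z /asboolP xy /asboolP yz; apply/asboolP.
by apply: filterS2 xy yz => i /= ->.
Qed.

Canonical ueq_equiv (S : choiceType) :=
  EquivRel (@ueq S) (@ueq_refl S) (@ueq_sym S) (@ueq_trans S).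

Definition star (S : choiceType) := {eq_quot (ueq_equiv S)}.
HB.instance Definition _ (S : choiceType) := EqQuotient.on (star S).
HB.instance Definition _ (S : choiceType) := Choice.on (star S).

Definition seqcls (S : choiceType) (x : nat -> S) : star S :=
  (\pi_(star S) x)%qT.

Definition sconst (S : choiceType) (a : S) : star S := seqcls (fun=> a).

(* Componentwise extension; independence of the representatives is smap_cls,
   smap2_cls and srel_cls. *)
Definition smap (S T : choiceType) (h : S -> T) (x : star S) : star T :=
  seqcls (fun i => h (repr x i)).

Definition smap2 (S T V : choiceType) (h : S -> T -> V)
    (x : star S) (y : star T) : star V :=
  seqcls (fun i => h (repr x i) (repr y i)).

Definition srel (S T : choiceType) (r : S -> T -> Prop)
    (x : star S) (y : star T) : Prop :=
  npu U [set i | r (repr x i) (repr y i)].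

Definition sle (d : Order.disp_t) (T : porderType d) (x y : star T) : Prop :=
  srel (fun a b => (a <= b)%O) x y.

Definition slt (d : Order.disp_t) (T : porderType d) (x y : star T) : Prop :=
  srel (fun a b => (a < b)%O) x y.

Lemma seqcls_eq (S : choiceType) (x y : nat -> S) :
  seqcls x = seqcls y <-> npu U [set i | x i = y i].
Proof.
split=> [/eqP|xy]; first by rewrite piE => /asboolP.
by apply/eqP; rewrite piE; apply/asboolP.
Qed.

Lemma seqcls_repr (S : choiceType) (x : star S) : seqcls (repr x) = x.
Proof. exact: reprK. Qed.

Lemma repr_seqcls (S : choiceType) (x : nat -> S) :
  npu U [set i | repr (seqcls x) i = x i].
Proof. by apply/seqcls_eq; rewrite seqcls_repr. Qed.

Lemma smap_cls (S T : choiceType) (h : S -> T) (x : nat -> S) :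
  smap h (seqcls x) = seqcls (fun i => h (x i)).
Proof. by apply/seqcls_eq; apply: filterS (repr_seqcls x) => i /= ->. Qed.

Lemma smap2_cls (S T V : choiceType) (h : S -> T -> V)
    (x : nat -> S) (y : nat -> T) :
  smap2 h (seqcls x) (seqcls y) = seqcls (fun i => h (x i) (y i)).
Proof.
apply/seqcls_eq; apply: filterS2 (repr_seqcls x) (repr_seqcls y).
by move=> i /= -> ->.
Qed.

Lemma srel_cls (S T : choiceType) (r : S -> T -> Prop)
    (x : nat -> S) (y : nat -> T) :
  srel r (seqcls x) (seqcls y) <-> npu U [set i | r (x i) (y i)].
Proof.
split; apply: filterS3 (repr_seqcls x) (repr_seqcls y) => i /= + + H.
  by move=> <- <-.
by move=> -> ->.
Qed.

Section Hyperreals.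
Variable R : realType.
Local Notation sR := (star R).

Definition sabs : sR -> sR := smap (fun a : R => `|a|).
Definition ssub : sR -> sR -> sR := smap2 (fun a b : R => a - b).
Definition smul : sR -> sR -> sR := smap2 (fun a b : R => a * b).
Definition spow : sR -> sR -> sR := smap2 (fun a r : R => a `^ r).
Definition sopp : sR -> sR := smap (fun a : R => - a).

Definition infinitesimal (x : sR) : Prop :=
  forall e : R, 0 < e -> slt (sabs x) (sconst e).

Definition infinite (x : sR) : Prop :=
  forall M : R, slt (sconst M) (sabs x).

Definition infclose (x y : sR) : Prop := infinitesimal (ssub x y).

Definition fin_pos_unit (x : sR) : Prop :=
  [/\ slt (sconst 0) x, ~ infinite x & ~ infinitesimal x].

Definition snneg := {x : sR | `[< sle (sconst 0) x >]}.
HB.instance Definition _ := Choice.on snneg.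

(* Orbits of the positive, neither infinite nor infinitesimal, hyperreals acting
   by multiplication. *)
Definition PReq : rel snneg :=
  fun x y => `[< exists2 u, fin_pos_unit u & val y = smul u (val x) >].

Lemma ultraN (A : set nat) : ~ npu U A -> npu U (~` A).
Proof. by move=> nA; have [] := in_ultra_setVsetC A (npu_ultra U). Qed.

Lemma fin_pos_unit_cls (u : nat -> R) : fin_pos_unit (seqcls u) <->
  exists2 M, 0 < M & npu U [set i | M^-1 <= u i <= M].
Proof.
split=> [[/srel_cls u0 /existsNP[M uM] /existsNP[e /not_implyP[e0 ue]]]|].
  move: uM ue; rewrite /slt /sabs smap_cls => uM ue.
  have {}uM : npu U [set i | `|u i| <= M].
    have /ultraN : ~ npu U [set i | M < `|u i|] by move=> H; apply: uM; apply/srel_cls.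
    by apply: filterS => i /= /negP; rewrite -leNgt.
  have {}ue : npu U [set i | e <= `|u i|].
    have /ultraN : ~ npu U [set i | `|u i| < e] by move=> H; apply: ue; apply/srel_cls.
    by apply: filterS => i /= /negP; rewrite -leNgt.
  exists (Num.max M e^-1); first by rewrite lt_max invr_gt0 e0 orbT.
  apply: filterS3 u0 uM ue => i /= u0; rewrite gtr0_norm // => uM ue.
  rewrite le_max uM andbT (le_trans _ ue) // -[leRHS]invrK lef_pV2 ?posrE.
  - by rewrite le_max lexx orbT.
  - by rewrite lt_max invr_gt0 e0 orbT.
  - by rewrite invr_gt0.
move=> [M M0 uM]; have u0 : npu U [set i | 0 < u i].
  by apply: filterS uM => i /= /andP[+ _]; apply: lt_le_trans; rewrite invr_gt0.
split; first exact/srel_cls.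
- move=> /(_ M); rewrite /sabs smap_cls => /srel_cls H; apply: (@filter_not_empty _ (npu U)).
  apply: filterS3 uM u0 H => i /= /andP[_ uM] u0.
  by rewrite gtr0_norm // ltNge uM.
- move=> /(_ M^-1); rewrite invr_gt0 => /(_ M0); rewrite /sabs smap_cls => /srel_cls H.
  apply: (@filter_not_empty _ (npu U)).
  apply: filterS3 uM u0 H => i /= /andP[uM _] u0.
  by rewrite gtr0_norm // ltNge uM.
Qed.

Lemma PReq_refl : reflexive PReq.
Proof.
move=> x; apply/asboolP; exists (sconst 1).
  by apply/fin_pos_unit_cls; exists 1 => //; apply: filterS filterT => i _ /=;
     rewrite invr1 lexx.
rewrite -[in RHS](seqcls_repr (val x)) /smul smap2_cls -[LHS]seqcls_repr.
by apply/seqcls_eq; apply: filterS filterT => i _ /=; rewrite mul1r.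
Qed.

Let PReq_symW x y : PReq x y -> PReq y x.
Proof.
move=> /asboolP[u + E]; rewrite -[u]seqcls_repr => /fin_pos_unit_cls[M M0 uM].
apply/asboolP; exists (seqcls (fun i => (repr u i)^-1)).
  apply/fin_pos_unit_cls; exists M => //; apply: filterS uM => i /= /andP[uM Mu].
  have u0 : 0 < repr u i by apply: lt_le_trans uM; rewrite invr_gt0.
  by rewrite lef_pV2 ?posrE // Mu -[leRHS]invrK lef_pV2 ?posrE ?invr_gt0.
rewrite E -(seqcls_repr u) -(seqcls_repr (val x)) /smul !smap2_cls.
apply/seqcls_eq; apply: filterS2 (repr_seqcls (repr u)) uM => i /= -> /andP[uM _].
by rewrite mulKf // gt_eqF // (lt_le_trans _ uM) // invr_gt0.
Qed.

Lemma PReq_sym : symmetric PReq.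
Proof. by move=> x y; apply/idP/idP; exact: PReq_symW. Qed.

Lemma PReq_trans : transitive PReq.
Proof.
move=> y x z /asboolP[u + E] /asboolP[v + F].
rewrite -[u]seqcls_repr -[v]seqcls_repr.
move=> /fin_pos_unit_cls[M M0 uM] /fin_pos_unit_cls[N N0 vN].
apply/asboolP; exists (seqcls (fun i => repr v i * repr u i)).
  apply/fin_pos_unit_cls; exists (N * M); first exact: mulr_gt0.
  apply: filterS2 uM vN => i /= /andP[u1 u2] /andP[v1 v2].
  have u0 : 0 < repr u i by apply: lt_le_trans u1; rewrite invr_gt0.
  have v0 : 0 < repr v i by apply: lt_le_trans v1; rewrite invr_gt0.
  by rewrite invfM !ler_pM // ?invr_ge0 ltW.
rewrite F E -(seqcls_repr u) -(seqcls_repr v) -(seqcls_repr (val x)).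
rewrite /smul !smap2_cls !seqcls_repr.
by apply/seqcls_eq; apply: filterS filterT => i _ /=; rewrite mulrA.
Qed.

Canonical PReq_equiv := EquivRel PReq PReq_refl PReq_sym PReq_trans.

Definition PR := {eq_quot PReq_equiv}.
HB.instance Definition _ := EqQuotient.on PR.
HB.instance Definition _ := Choice.on PR.

Lemma sabs_ge0 (x : sR) : `[< sle (sconst 0) (sabs x) >].
Proof. by apply/asboolP/srel_cls; apply: filterS filterT => i _ /=. Qed.

(* The class of the absolute value of x. *)
Definition PRcls (x : sR) : PR := (\pi_PR (exist _ (sabs x) (sabs_ge0 x)))%qT.

(* An arbitrary representative; PRmul_cls and PRpow_cls show that PRmul and PRpow
   do not depend on it, the latter for bounded nonnegative exponents. *)
Definition PRrep (m : PR) : sR := val (repr m).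

Definition PRle (m n : PR) : Prop := exists x y : sR,
  [/\ sle (sconst 0) x, sle (sconst 0) y, m = PRcls x, n = PRcls y & sle x y].

Definition PRlt (m n : PR) : Prop := PRle m n /\ m <> n.

(* Tropical sum: the maximum. *)
Definition PRadd (m n : PR) : PR := if `[< PRle m n >] then n else m.

Definition PRmul (m n : PR) : PR := PRcls (smul (PRrep m) (PRrep n)).

Definition PRact (x : sR) (m : PR) : PR := PRmul (PRcls x) m.

Definition PRpow (m : PR) (r : sR) : PR := PRcls (spow (PRrep m) r).

Definition PReps : set PR :=
  [set m | exists x : sR, [/\ slt (sconst 0) x, infinitesimal x & m = PRcls x]].

Lemma sabs_nneg (x : sR) : sle (sconst 0) x -> sabs x = x.
Proof.
rewrite -(seqcls_repr x) /sabs smap_cls => /srel_cls x0; apply/seqcls_eq.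
by apply: filterS x0 => i /= x0; rewrite ger0_norm.
Qed.

Lemma PRcls_eq (x y : sR) : sle (sconst 0) x -> sle (sconst 0) y ->
  PRcls x = PRcls y <-> exists2 u, fin_pos_unit u & y = smul u x.
Proof.
move=> x0 y0; split=> [/eqP|H]; first by rewrite piE => /asboolP /=; rewrite !sabs_nneg.
by apply/eqP; rewrite piE; apply/asboolP => /=; rewrite !sabs_nneg.
Qed.

Lemma PRrep_ge0 (m : PR) : sle (sconst 0) (PRrep m).
Proof. by have /asboolP := valP (repr m). Qed.

Lemma PRrepK (m : PR) : PRcls (PRrep m) = m.
Proof.
rewrite -[RHS]reprK /PRcls; congr (\pi_PR _)%qT; apply/val_inj => /=.
by rewrite sabs_nneg //; exact: PRrep_ge0.
Qed.

Lemma smul_ge0 (x y : sR) :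
  sle (sconst 0) x -> sle (sconst 0) y -> sle (sconst 0) (smul x y).
Proof.
rewrite -(seqcls_repr x) -(seqcls_repr y) /smul smap2_cls.
move=> /srel_cls x0 /srel_cls y0; apply/srel_cls.
by apply: filterS2 x0 y0 => i /=; exact: mulr_ge0.
Qed.

Lemma spow_ge0 (x r : sR) : sle (sconst 0) (spow x r).
Proof. by apply/srel_cls; apply: filterS filterT => i _ /=; exact: powR_ge0. Qed.

Lemma PRrep_cls (x : sR) : sle (sconst 0) x ->
  exists2 u, fin_pos_unit u & PRrep (PRcls x) = smul u x.
Proof.
by move=> x0; apply/PRcls_eq => //; [exact: PRrep_ge0|rewrite PRrepK].
Qed.

Lemma PRmul_cls (x y : sR) : sle (sconst 0) x -> sle (sconst 0) y ->
  PRmul (PRcls x) (PRcls y) = PRcls (smul x y).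
Proof.
move=> x0 y0; have [u] := PRrep_cls x0; have [v] := PRrep_cls y0.
move=> + Ev + Eu; rewrite -[u]seqcls_repr -[v]seqcls_repr.
move=> /fin_pos_unit_cls[N N0 vN] /fin_pos_unit_cls[M M0 uM].
apply/esym/PRcls_eq; first exact: smul_ge0.
  by apply: smul_ge0; exact: PRrep_ge0.
exists (seqcls (fun i => repr v i * repr u i)).
  apply/fin_pos_unit_cls; exists (N * M); first exact: mulr_gt0.
  apply: filterS2 uM vN => i /= /andP[u1 u2] /andP[v1 v2].
  have u0' : 0 < repr u i by apply: lt_le_trans u1; rewrite invr_gt0.
  have v0' : 0 < repr v i by apply: lt_le_trans v1; rewrite invr_gt0.
  by rewrite invfM !ler_pM // ?invr_ge0 ltW.
rewrite Eu Ev -(seqcls_repr u) -(seqcls_repr v) -(seqcls_repr x) -(seqcls_repr y).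
rewrite /smul !smap2_cls !seqcls_repr.
by apply/seqcls_eq; apply: filterS filterT => i _ /=; rewrite mulrACA [_ * repr v i]mulrC.
Qed.

Lemma PRpow_cls (x r : sR) : sle (sconst 0) x -> sle (sconst 0) r ->
  ~ infinite r -> PRpow (PRcls x) r = PRcls (spow x r).
Proof.
move=> x0 r0 rfin; have [u + Eu] := PRrep_cls x0.
rewrite -[u]seqcls_repr => /fin_pos_unit_cls[M M0 uM].
have [B rB] : exists B, npu U [set i | `|repr r i| <= B].
  move: rfin => /existsNP[B rB]; exists B.
  have /ultraN : ~ npu U [set i | B < `|repr r i|].
    by move=> H; apply: rB; rewrite /sabs -(seqcls_repr r) smap_cls; apply/srel_cls.
  by apply: filterS => i /= /negP; rewrite -leNgt.
apply/esym/PRcls_eq; [exact: spow_ge0|exact: spow_ge0|].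
move: x0 r0; rewrite -(seqcls_repr x) -(seqcls_repr r) => /srel_cls x0 /srel_cls r0.
exists (seqcls (fun i => repr u i `^ repr r i)); last first.
  rewrite seqcls_repr Eu -(seqcls_repr u) -{2}(seqcls_repr x) -{1}(seqcls_repr x).
  rewrite /smul /spow !smap2_cls !seqcls_repr; apply/seqcls_eq.
  apply: filterS2 x0 uM => i /= x0 /andP[u1 _]; rewrite powRM //.
  by rewrite (le_trans _ u1) // invr_ge0 ltW.
pose M' := Num.max 1 M; have M1 : 1 <= M' by rewrite le_max lexx.
apply/fin_pos_unit_cls; exists (M' `^ B); first by apply: powR_gt0; apply: lt_le_trans M1.
apply: filterS3 uM rB r0 => i /= /andP[u1 u2] rB r0.
rewrite ger0_norm // in rB.
have u0 : 0 < repr u i by apply: lt_le_trans u1; rewrite invr_gt0.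
have M'0 : 0 < M' by apply: lt_le_trans M1.
apply/andP; split; last first.
  apply: (@le_trans _ _ (M' `^ repr r i)); last exact: ler_powR.
  apply: ge0_ler_powR => //; rewrite ?nnegrE ?(ltW u0) ?(ltW M'0) //.
  by rewrite le_max u2 orbT.
apply: (@le_trans _ _ (M' `^ repr r i)^-1).
  by rewrite lef_pV2 ?posrE ?powR_gt0 // ler_powR.
have -> : (M' `^ repr r i)^-1 = M'^-1 `^ repr r i.
  by rewrite -powRN -[M'^-1]powR_inv1 ?ltW // -powRrM mulN1r.
apply: ge0_ler_powR => //; rewrite ?nnegrE ?invr_ge0 ?(ltW u0) ?(ltW M'0) //.
by apply: le_trans u1; rewrite lef_pV2 ?posrE // le_max lexx orbT.
Qed.

End Hyperreals.
End Ultrapower.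

Definition deg (p : {poly int}) : nat := (size p).-1.

Definition height (p : {poly int}) : nat := \max_(i < size p) `|(p`_i)%R|%N.

Section ComplexRoots.
Variable R : realType.
Implicit Types p f g : {poly int}.

(* The complex roots of a nonzero p, listed with multiplicity. *)
Definition croots p : seq R[i] :=
  sval (closed_field_poly_normal (map_poly intr p)).

Definition mahler p : R :=
  `|(lead_coef p)%:~R| * \prod_(z <- croots p) Num.max 1 (Normc.normc z).

Definition boxtimesC f g : {poly R[i]} :=
  ((lead_coef f)%:~R ^+ deg g * (lead_coef g)%:~R ^+ deg f) *:
    \prod_(a <- croots f) \prod_(b <- croots g) ('X - (a * b)%:P).

(* The unique integer polynomial with image boxtimesC f g, see boxtimesE;
   the value 0 for f = 0 or g = 0 is a convention. *)
Definition boxtimes f g : {poly int} :=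
  if (f == 0) || (g == 0) then 0
  else xget 0 [set h | map_poly intr h = boxtimesC f g].

Lemma crootsE p :
  map_poly intr p = (lead_coef p)%:~R *: \prod_(z <- croots p) ('X - z%:P).
Proof.
rewrite /croots; case: closed_field_poly_normal => s /= {1}->.
by rewrite lead_coef_map_inj //; exact: intr_inj.
Qed.

Lemma size_croots p : p != 0 -> size (croots p) = deg p.
Proof.
move=> p0; have /(congr1 (fun q : {poly R[i]} => size q)) := crootsE p.
rewrite size_map_inj_poly //; last exact: intr_inj.
rewrite size_scale ?intr_eq0 ?lead_coef_eq0 // size_prod_XsubC /deg => ->.
by [].
Qed.

Lemma boxtimesE f g : f != 0 -> g != 0 ->
  map_poly intr (boxtimes f g) = boxtimesC f g.
Proof.
move=> f0 g0; rewrite /boxtimes (negPf f0) (negPf g0) /=.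
have [h hE] := box_integral (crootsE f) (crootsE g).
by apply: (@xgetI _ 0 [set h | map_poly intr h = boxtimesC f g] h);
  rewrite /= hE !size_croots.
Qed.

End ComplexRoots.

Section StarPolynomials.
Variables (R : realType) (U : npultra).
Local Notation sR := (star U R).
Local Notation sN := (star U nat).
Local Notation sZX := (star U {poly int}).
Local Notation PR := (PR U R).
Implicit Types (f g : sZX) (d e : sN) (m : PR) (t : R).

Definition sdeg : sZX -> sN := smap deg.

Definition seval t : sZX -> sR := smap (fun p => (map_poly intr p).[t]).

Definition sheight : sZX -> sR := smap (fun p => (height p)%:R).

Definition smahler : sZX -> sR := smap (@mahler R).

Definition sboxtimes : sZX -> sZX -> sZX := smap2 (@boxtimes R).

Definition smuln : sN -> sN -> sN := smap2 muln.

Definition sinvn : sN -> sR := smap (fun n => n%:R^-1).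

Definition s1Binvn : sN -> sR := smap (fun n => 1 - n%:R^-1).

Definition mahlerd d f : sR := spow (smahler f) (sinvn d).

Definition growth d f : PR := PRcls (spow (sheight f) (sopp (sinvn d))).

Definition decay d t f : PR := PRcls (spow (sabs (seval t f)) (sinvn d)).

Definition Zvan t : set sZX := [set f | infclose (seval t f) (sconst U 0)].

(* The growth of 0 is a negative power of the height 0; it is read as
   infinite, so that 0 belongs to every Zgrow. *)
Definition Zgrow m t d : set sZX :=
  [set f | [/\ Zvan t f, sle (sdeg f) d &
             f <> sconst U 0 -> PRlt m (growth d f)]].

(* Zgrow m t d and Zgrowdec m l e t d are Z^m(t)_d and Z^m_{l^e}(t)_d; the
   condition of the latter is on the e-th root of the decay. *)
Definition Zgrowdec m (l : PR) e t d : set sZX :=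
  [set f | Zgrow m t d f /\ PRle (PRpow (decay d t f) (sinvn e)) l].

End StarPolynomials.

(* Main.v *)
(** Write [f = a prod (X - x)] and [g = b prod (X - y)], of degrees [m] and [n], and let
    [M(z) = max(1, |z|)].  The value of [f ⊠ g] at [theta * eta] is
    [a^n b^m prod (theta * eta - x * y)], and
    [theta * eta - x * y = (theta - x) * y + theta * (eta - y)].  Either every root [x] has a
    root [y] for which the first summand dominates, and then each [|theta - x|] can be
    extracted once, or some [x] has the second summand dominant for all [y], and then each
    [|eta - y|] can be extracted once; the remaining factors are bounded by a constant times
    [M(x) M(y)].  Hence the value is at most
    [K^(mn) max(m(f)^(n-1) m(g)^m |f(theta)|, m(f)^n m(g)^(m-1) |g(eta)|)], and a [de]-th root
    turns [K^(mn)] into a finite constant, invisible in the projective classes.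

    For the map, [h(f ⊠ g) <= 2^(mn) m(f)^n m(g)^m] and [m(f) <= 2^m h(f)] (a weak form of
    Landau's inequality) make growth supermultiplicative, and show that [m(f)^(1/d) mu] and
    [m(g)^(1/e) nu] are infinitesimal, so that the first part forces the value of
    [f ⊠ g] at [theta * eta] to be infinitesimal.  Constants cause no trouble: a nonzero
    integer constant is not infinitesimal. *)

Require Import Defs.
From mathcomp Require Import all_boot all_order all_algebra.
From mathcomp Require Import all_classical all_reals.
From mathcomp Require Import complex exp ring lra.

Set Implicit Arguments.
Unset Strict Implicit.
Unset Printing Implicit Defensive.

Import Order.TTheory GRing.Theory Num.Theory.
Local Open Scope classical_set_scope.
Local Open Scope ring_scope.

(** * Modulus on the complex numbers, coefficient bounds from roots, and the l2 norm *)

Section ComplexModulus.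
Variable R : realType.
Implicit Types (x y z : R[i]) (s t : seq R[i]).
Local Notation normc := Normc.normc.
Local Arguments Normc.normc : simpl never.

Lemma normc_ge0 z : 0 <= normc z.
Proof. by case: z => a b /=; exact: sqrtr_ge0. Qed.

Lemma normc_real (a : R) : normc a%:C%C = `|a|.
Proof. by rewrite /Normc.normc /= expr0n addr0 sqrtr_sqr. Qed.

Lemma normc_int (n : int) : normc (n%:~R : R[i]) = `|n%:~R|.
Proof. by rewrite -normc_real rmorph_int. Qed.

Lemma normc_sqr z : normc z ^+ 2 = complex.Re z ^+ 2 + complex.Im z ^+ 2.
Proof. by case: z => a b; rewrite /Normc.normc sqr_sqrtr // addr_ge0 ?sqr_ge0. Qed.

Lemma normc_prod I (r : seq I) (F : I -> R[i]) :
  normc (\prod_(i <- r) F i) = \prod_(i <- r) normc (F i).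
Proof.
elim: r => [|i r IH]; first by rewrite !big_nil Normc.normc1.
by rewrite !big_cons Normc.normcM IH.
Qed.

Lemma normcX z n : normc (z ^+ n) = normc z ^+ n.
Proof. by elim: n => [|n IH]; rewrite ?Normc.normc1 // !exprS Normc.normcM IH. Qed.

Lemma normcB_le x y : normc (x - y) <= normc x + normc y.
Proof. by rewrite -(normcN y); exact: le_normcD. Qed.

Definition maxc1 z : R := Num.max 1 (normc z).

Lemma maxc1_ge1 z : 1 <= maxc1 z.
Proof. by rewrite le_max lexx. Qed.

Lemma maxc1_ge0 z : 0 <= maxc1 z.
Proof. exact: le_trans (maxc1_ge1 z). Qed.

Lemma normc_le_maxc1 z : normc z <= maxc1 z.
Proof. by rewrite le_max lexx orbT. Qed.

Lemma maxc1M x y : maxc1 (x * y) <= maxc1 x * maxc1 y.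
Proof.
rewrite ge_max Normc.normcM mulr_ege1 ?maxc1_ge1 //=.
by rewrite ler_pM ?normc_ge0 ?normc_le_maxc1.
Qed.

Lemma prod_maxc1_ge1 s : 1 <= \prod_(z <- s) maxc1 z.
Proof. by elim/big_ind: _ => // [x y|z _]; [exact: mulr_ege1|exact: maxc1_ge1]. Qed.

Lemma prod_maxc1_ge0 s : 0 <= \prod_(z <- s) maxc1 z.
Proof. exact: le_trans (prod_maxc1_ge1 s). Qed.

Lemma prodr_const_seq I (r : seq I) (x : R) : \prod_(i <- r) x = x ^+ size r.
Proof. by rewrite big_const_seq count_predT iter_mulr_1. Qed.

Lemma ler_prod_seq (I : eqType) (r : seq I) (F G : I -> R) :
  (forall i, i \in r -> 0 <= F i <= G i) ->
  \prod_(i <- r) F i <= \prod_(i <- r) G i.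
Proof. by move=> FG; rewrite big_seq [leRHS]big_seq; apply: ler_prod. Qed.

(** Multiplying by ['X - z] enlarges a uniform bound on the coefficients by at most the factor 1 +
    |z| <= 2 * [maxc1 z], hence the power of 2. *)
Lemma coef_prod_XsubC_le s k :
  normc (\prod_(z <- s) ('X - z%:P))`_k <= 2 ^+ size s * \prod_(z <- s) maxc1 z.
Proof.
elim: s k => [|z s IH] k; rewrite ?big_nil ?big_cons.
  by rewrite coef1; case: eqP => _; rewrite ?Normc.normc1 ?Normc.normc0 mul1r.
rewrite mulrBl coefB coefXM coefCM.
apply: (le_trans (normcB_le _ _)); rewrite Normc.normcM.
set B := (\prod_(w <- s) maxc1 w) in IH *; set c := 2 ^+ size s in IH.
have B0 : 0 <= c * B by apply: mulr_ge0; [rewrite exprn_ge0|exact: prod_maxc1_ge0].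
have -> : 2 ^+ size (z :: s) * (maxc1 z * B) = maxc1 z * (c * B) + maxc1 z * (c * B).
  by rewrite /= exprS -/c; ring.
apply: lerD; last by apply: ler_pM; rewrite ?normc_ge0 ?normc_le_maxc1.
case: k => [|k] /=.
  by rewrite Normc.normc0 mulr_ge0 // maxc1_ge0.
by apply: (le_trans (IH k)); rewrite ler_peMl // maxc1_ge1.
Qed.

(** The cut-off [N] is independent of [size p], so it can stay fixed while factors are exchanged. *)
Definition l2sq N (p : {poly R[i]}) : R := \sum_(i < N) normc p`_i ^+ 2.

(** At index i the two squared moduli have the same cross term and differ by (|z|^2 - 1)(|q_i|^2 -
    |q_{i-1}|^2). The sum of these differences telescopes, and both end terms vanish: there is no
    coefficient below index 0, and [size q < N] kills the top one. *)
Lemma l2sq_reflect N (q : {poly R[i]}) z : (size q < N)%N ->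
  l2sq N (q * ('X - z%:P)) = l2sq N (q * ((z^*)%C *: 'X - 1)).
Proof.
move=> sq; have EN := ltn_predK sq; rewrite -EN.
move: N.-1 EN sq => {}N <-; rewrite ltnS => sq.
have qN : q`_N = 0 by rewrite nth_default.
pose s (i : nat) : R := if i is j.+1 then normc q`_j ^+ 2 else 0.
apply/eqP; rewrite -subr_eq0 /l2sq -sumrB.
rewrite (eq_bigr (fun i : 'I_N.+1 => (normc z ^+ 2 - 1) * (s i.+1 - s i))).
  rewrite -mulr_sumr -(big_mkord xpredT (fun i => s i.+1 - s i)) telescope_sumr //.
  by rewrite /s qN Normc.normc0 expr0n /= subr0 mulr0.
move=> [i /= _] _.
have E1 : (q * ('X - z%:P))`_i = (if i is j.+1 then q`_j else 0) - q`_i * z.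
  by rewrite mulrBr coefB coefMX coefMC; case: (i).
have E2 : (q * ((z^*)%C *: 'X - 1))`_i = (z^*)%C * (if i is j.+1 then q`_j else 0) - q`_i.
  by rewrite mulrBr mulr1 -scalerAr coefB coefZ coefMX; case: (i).
rewrite [X in normc X ^+ 2 - _]E1 [X in _ - normc X ^+ 2]E2 {E1 E2}.
rewrite /s; case: i => [|i] /=.
  rewrite mulr0 !sub0r !normcN Normc.normcM; ring.
rewrite !normc_sqr; case: z => a b; case: q`_i => u v; case: q`_i.+1 => m n /=.
ring.
Qed.

(* A factor [X - z] with [|z| > 1] is traded for [z^* X - 1]: the [l2] norm is
   unchanged while the top coefficient picks up the factor [|z|]. *)
Lemma l2sq_prod_XsubC_ge s (q : {poly R[i]}) k N :
  (size q <= k.+1)%N -> (k + size s < N)%N ->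
  (normc q`_k * \prod_(z <- s) maxc1 z) ^+ 2 <=
  l2sq N (q * \prod_(z <- s) ('X - z%:P)).
Proof.
elim: s q k => [|z s IH] q k sq kN.
  rewrite !big_nil !mulr1 /l2sq; rewrite addn0 in kN.
  by rewrite (bigD1 (Ordinal kN)) //= lerDl sumr_ge0 // => i _; rewrite sqr_ge0.
rewrite !big_cons !mulrA; rewrite /= addnS -addSn in kN.
(* Here [r] stands for ['X - z] when |z| <= 1 and for the reflected factor otherwise. The
   coefficient of [q * r] at [k.+1] is the product of the two formal leading coefficients, so the
   induction continues with [q * r]. *)
have step (r : {poly R[i]}) : (size r <= 2)%N -> normc r`_1 = maxc1 z ->
    (normc q`_k * maxc1 z * \prod_(w <- s) maxc1 w) ^+ 2 <=
    l2sq N (q * r * \prod_(w <- s) ('X - w%:P)).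
  move=> sr r1; rewrite -r1 -Normc.normcM.
  have -> : q`_k * r`_1 = (q * r)`_k.+1.
    rewrite coefM (bigD1 (inord k)) //= inordK ?ltnS // subSnn [X in _ + X]big1 ?addr0 //.
    move=> [i /= ik]; rewrite -val_eqE /= inordK ?ltnS // => ik'.
    have [ki|ki] := ltnP k i; first by rewrite nth_default ?mul0r // (leq_trans sq).
    rewrite [r`__]nth_default ?mulr0 // (leq_trans sr) //.
    by rewrite ltn_subRL addn1 ltnS ltn_neqAle ik'.
  apply: IH => //; apply: (leq_trans (size_polyMleq _ _)).
  by rewrite -subn1 leq_subLR (leq_trans (leq_add sq sr)) // addn2.
have [z1|z1] := leP (normc z) 1.
  apply: step; first by rewrite size_XsubC.
  by rewrite coefB coefX coefC /= subr0 Normc.normc1 /maxc1 max_l.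
rewrite [q * _ * _]mulrAC l2sq_reflect; last first.
  apply: (leq_ltn_trans (size_polyMleq _ _)).
  rewrite size_prod_XsubC addnS /=; apply: leq_ltn_trans (kN).
  by rewrite leq_add2r.
rewrite [q * _ * _]mulrAC; apply: step.
  apply: (leq_trans (size_polyD _ _)); rewrite size_polyN size_poly1 geq_max andbT.
  by apply: (leq_trans (size_scale_leq _ _)); rewrite size_polyX.
rewrite coefB coefZ coefX coef1 /= mulr1 subr0 /maxc1 max_r ?(ltW z1) //.
by case: (z) => a b; rewrite /Normc.normc /= sqrrN.
Qed.

End ComplexModulus.

(** * Mahler measure, height and values of integer polynomials and of their resultant product *)

Section PolynomialBounds.
Variable R : realType.
Implicit Types (f g p : {poly int}) (x y z : R[i]) (s t : seq R[i]).
Local Notation normc := Normc.normc.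
Local Arguments Normc.normc : simpl never.
Local Notation peval p t := ((map_poly intr p).[t : R]).

Lemma mahlerE p : mahler R p = `|(lead_coef p)%:~R| * \prod_(z <- croots R p) maxc1 z.
Proof. by []. Qed.

Lemma norm_lead_coef_ge1 p : p != 0 -> 1 <= `|(lead_coef p)%:~R : R|.
Proof. by move=> p0; rewrite -intr_norm ler1z -gtz0_ge1 normr_gt0 lead_coef_eq0. Qed.

Lemma mahler_ge1 p : p != 0 -> 1 <= mahler R p.
Proof. by move=> p0; rewrite mahlerE mulr_ege1 ?norm_lead_coef_ge1 ?prod_maxc1_ge1. Qed.

Lemma mahler_ge0 p : 0 <= mahler R p.
Proof. by rewrite mahlerE mulr_ge0 ?prod_maxc1_ge0. Qed.

Lemma coef_le_height p i : (`|(p`_i)%R| <= height p)%N.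
Proof.
have [pi|ip] := leqP (size p) i; first by rewrite nth_default.
exact: (@leq_bigmax _ (fun j : 'I_(size p) => `|(p`_j)%R|%N) (Ordinal ip)).
Qed.

(** Taking the constant [lead_coef p] for [q] in [l2sq_prod_XsubC_ge] bounds the squared Mahler
    measure by the sum of the squared coefficients. This is at most (deg + 1) height^2, and deg + 1
    <= 2^deg <= 4^deg. *)
Lemma mahler_le_height p : mahler R p <= 2 ^+ deg p * (height p)%:R.
Proof.
have [->|p0] := eqVneq p 0.
  by rewrite mahlerE lead_coef0 normr0 mul0r mulr_ge0 ?exprn_ge0.
rewrite -(@ler_pXn2r _ 2) ?nnegrE ?mahler_ge0 ?mulr_ge0 ?exprn_ge0 //.
have := @l2sq_prod_XsubC_ge _ (croots R p) ((lead_coef p)%:~R)%:P 0 (deg p).+1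
          (size_polyC_leq1 _).
rewrite size_croots // add0n ltnSn => /(_ isT).
rewrite coefC eqxx normc_int -mahlerE mul_polyC -crootsE => /le_trans; apply.
apply: (@le_trans _ _ (\sum_(i < (deg p).+1) (height p)%:R ^+ 2)).
  apply: ler_sum => i _; rewrite coef_map normc_int.
  by rewrite lerXn2r ?nnegrE // -intr_norm -natr_absz ler_nat coef_le_height.
rewrite sumr_const card_ord exprMn -[leLHS]mulr_natl ler_wpM2r ?sqr_ge0 //.
rewrite -natrX -natrX ler_nat (leq_trans (ltn_expl _ (isT : 1 < 2)%N)) //.
by rewrite -expnM leq_pexp2l // leq_pmulr.
Qed.

Lemma height_le p (B : R) : (forall i, `|(p`_i)%:~R| <= B) -> (height p)%:R <= B.
Proof.
move=> pB; have B0 : 0 <= B by apply: le_trans (pB 0%N).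
rewrite /height; elim/big_ind: _ => // [m n mB nB|i _].
  by rewrite /maxn; case: ifP.
by rewrite natr_absz intr_norm.
Qed.

Lemma norm_horner p (t : R) :
  `|peval p t| = `|(lead_coef p)%:~R| * \prod_(z <- croots R p) normc (t%:C%C - z).
Proof.
rewrite -normc_real -horner_map -map_poly_comp.
rewrite (@eq_map_poly _ _ _ intr); last by move=> n /=; rewrite rmorph_int.
rewrite crootsE hornerZ horner_prod Normc.normcM normc_prod normc_int.
by congr (_ * _); apply: eq_bigr => z _; rewrite hornerXsubC.
Qed.

(** A single list of roots is the form to which [coef_prod_XsubC_le] applies. *)
Lemma boxtimesCE f g : boxtimesC R f g =
  ((lead_coef f)%:~R ^+ deg g * (lead_coef g)%:~R ^+ deg f) *:
    \prod_(z <- [seq x * y | x <- croots R f, y <- croots R g]) ('X - z%:P).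
Proof. by rewrite /boxtimesC big_allpairs_dep. Qed.

Lemma size_boxtimes f g : f != 0 -> g != 0 ->
  size (boxtimes R f g) = (deg f * deg g).+1.
Proof.
move=> f0 g0; have /(congr1 (fun q : {poly R[i]} => size q)) := boxtimesE R f0 g0.
rewrite size_map_inj_poly //; last exact: intr_inj.
rewrite boxtimesCE size_scale ?mulf_neq0 ?expf_neq0 ?intr_eq0 ?lead_coef_eq0 //.
by rewrite size_prod_XsubC size_allpairs !size_croots.
Qed.

Lemma boxtimes_neq0 f g : f != 0 -> g != 0 -> boxtimes R f g != 0.
Proof. by move=> f0 g0; rewrite -size_poly_eq0 size_boxtimes. Qed.

Lemma deg_boxtimes f g : f != 0 -> g != 0 -> deg (boxtimes R f g) = (deg f * deg g)%N.
Proof. by move=> f0 g0; rewrite /deg size_boxtimes. Qed.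

(** The coefficient bound is applied to the list of all products x * y. By [maxc1M] the product over
    pairs splits into powers of the products over the roots of [f] and of [g], which the leading
    coefficients complete to Mahler measures. *)
Lemma height_boxtimes_le f g : f != 0 -> g != 0 ->
  (height (boxtimes R f g))%:R <=
  2 ^+ (deg f * deg g) * (mahler R f ^+ deg g * mahler R g ^+ deg f).
Proof.
move=> f0 g0; apply: height_le => i.
rewrite -normc_int -coef_map boxtimesE // boxtimesCE coefZ !Normc.normcM !normcX !normc_int.
rewrite !mahlerE !exprMn.
have := coef_prod_XsubC_le [seq x * y | x <- croots R f, y <- croots R g] i.
rewrite size_allpairs !size_croots // [X in _ <= _ * X]big_allpairs_dep => H.
rewrite [X in _ <= _ * X]mulrACA [leRHS]mulrCA.
apply: ler_pM; rewrite ?mulr_ge0 ?exprn_ge0 ?normc_ge0 //; apply: (le_trans H).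
rewrite ler_wpM2l ?exprn_ge0 //.
apply: (@le_trans _ _ (\prod_(x <- croots R f) \prod_(y <- croots R g) (maxc1 x * maxc1 y))).
  apply: ler_prod_seq => x _; rewrite prodr_ge0 /=; last by move=> *; exact: maxc1_ge0.
  by apply: ler_prod_seq => y _; rewrite maxc1_ge0 maxc1M.
under eq_bigr do rewrite big_split /= prodr_const_seq.
by rewrite big_split /= prodr_const_seq prodrXl !size_croots.
Qed.

Lemma norm_horner_boxtimes f g (t : R) : f != 0 -> g != 0 ->
  `|peval (boxtimes R f g) t| =
  `|(lead_coef f)%:~R| ^+ deg g * `|(lead_coef g)%:~R| ^+ deg f *
  \prod_(x <- croots R f) \prod_(y <- croots R g) normc (t%:C%C - x * y).
Proof.
move=> f0 g0; rewrite -normc_real -horner_map -map_poly_comp.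
rewrite (@eq_map_poly _ _ _ intr); last by move=> n /=; rewrite rmorph_int.
rewrite boxtimesE // /boxtimesC hornerZ horner_prod !Normc.normcM normc_prod !normcX !normc_int.
congr (_ * _); apply: eq_bigr => x _; rewrite horner_prod normc_prod.
by apply: eq_bigr => y _; rewrite hornerXsubC.
Qed.

End PolynomialBounds.

(** * Products of the distances between u * v and the x * y *)

Section ProductDistance.
Variable R : realType.
Implicit Types (x y : R[i]) (s t : seq R[i]).
Local Notation normc := Normc.normc.
Local Arguments Normc.normc : simpl never.
Variables (u v : R[i]) (K : R).
(** The three bounds serve the factor singled out in [prod_dist_left], the factors in
    [prod_dist_right], and [dist_le], respectively. *)
Hypothesis K_bounds : [/\ 2 <= K, 2 * normc u <= K & 1 + normc u * normc v <= K].

Let K_ge0 : 0 <= K.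
Proof. by have [? _ _] := K_bounds; lra. Qed.

Let normc_mulB x y :
  normc (u * v - x * y) <= normc (u - x) * normc y + normc u * normc (v - y).
Proof.
rewrite -!Normc.normcM; have -> : u * v - x * y = (u - x) * y + u * (v - y) by ring.
exact: le_normcD.
Qed.

Let dist_le x y : normc (u * v - x * y) <= K * (maxc1 x * maxc1 y).
Proof.
have [_ _ K1] := K_bounds; apply: (le_trans (normcB_le _ _)); rewrite !Normc.normcM.
have xy : normc x * normc y <= maxc1 x * maxc1 y.
  by rewrite ler_pM ?normc_ge0 ?normc_le_maxc1.
have xy1 : 1 <= maxc1 x * maxc1 y by rewrite mulr_ege1 ?maxc1_ge1.
have uv0 : 0 <= normc u * normc v by rewrite mulr_ge0 ?normc_ge0.
nra.
Qed.

(** Only the factor at [y0] uses the hypothesis: it is at most 2 |u - x| |y0|. The others take the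
    crude bound [dist_le], so [maxc1 x] occurs [(size t).-1] times. *)
Let prod_dist_left x y0 t : y0 \in t ->
  normc u * normc (v - y0) <= normc (u - x) * normc y0 ->
  \prod_(y <- t) normc (u * v - x * y) <=
  K ^+ size t * (normc (u - x) * (maxc1 x ^+ (size t).-1 * \prod_(y <- t) maxc1 y)).
Proof.
move=> y0t le0; have [K2 _ _] := K_bounds.
rewrite !(big_rem y0 y0t) /=.
have E : \prod_(y <- rem y0 t) (K * (maxc1 x * maxc1 y)) =
    K ^+ (size t).-1 * maxc1 x ^+ (size t).-1 * \prod_(y <- rem y0 t) maxc1 y.
  by rewrite !big_split /= !prodr_const_seq size_rem // mulrA.
have t0 : (0 < size t)%N by case: (t) y0t.
rewrite -[in leRHS](prednK t0) /= exprS.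
set P := \prod_(y <- rem y0 t) maxc1 y in E *.
set C := K ^+ _ in E *; set D := maxc1 x ^+ _ in E *.
have -> : K * C * (normc (u - x) * (D * (maxc1 y0 * P))) =
          (K * (normc (u - x) * maxc1 y0)) * (C * D * P) by ring.
rewrite -E; apply: ler_pM; rewrite ?normc_ge0 ?prodr_ge0 //.
- by move=> *; exact: normc_ge0.
- apply: (le_trans (normc_mulB _ _)).
  have dM : normc (u - x) * normc y0 <= normc (u - x) * maxc1 y0.
    by rewrite ler_wpM2l ?normc_ge0 ?normc_le_maxc1.
  have dM0 : 0 <= normc (u - x) * maxc1 y0 by rewrite mulr_ge0 ?normc_ge0 ?maxc1_ge0.
  nra.
- by apply: ler_prod_seq => y _; rewrite normc_ge0 dist_le.
Qed.

(** Each factor is at most 2 |u| |v - y|, so one [x] alone yields all the |v - y|. *)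
Let prod_dist_right x t :
  (forall y, y \in t -> normc (u - x) * normc y < normc u * normc (v - y)) ->
  \prod_(y <- t) normc (u * v - x * y) <= K ^+ size t * \prod_(y <- t) normc (v - y).
Proof.
move=> lt; have [_ K2 _] := K_bounds.
rewrite -prodr_const_seq -big_split /=; apply: ler_prod_seq => y yt.
rewrite normc_ge0 /=; apply: (le_trans (normc_mulB _ _)).
by have := lt y yt; have := normc_ge0 (v - y); nra.
Qed.

Let prod_dist x t :
  \prod_(y <- t) normc (u * v - x * y) <=
  K ^+ size t * (maxc1 x ^+ size t * \prod_(y <- t) maxc1 y).
Proof.
rewrite -!prodr_const_seq -!big_split /=; apply: ler_prod_seq => y _.
by rewrite normc_ge0 dist_le.
Qed.

Lemma prod_prod_dist_le s t :
  \prod_(x <- s) \prod_(y <- t) normc (u * v - x * y) <=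
  K ^+ (size s * size t) * Num.max
    ((\prod_(x <- s) maxc1 x) ^+ (size t).-1 * (\prod_(y <- t) maxc1 y) ^+ size s *
       \prod_(x <- s) normc (u - x))
    ((\prod_(x <- s) maxc1 x) ^+ size t * (\prod_(y <- t) maxc1 y) ^+ (size s).-1 *
       \prod_(y <- t) normc (v - y)).
Proof.
have KX n : 0 <= K ^+ n by rewrite exprn_ge0.
have Mt : 0 <= \prod_(y <- t) maxc1 y by exact: prod_maxc1_ge0.
rewrite mulnC exprM maxr_pMr ?exprn_ge0 // le_max.
have [P|/existsNP[x0 /not_implyP[x0s Q]]] := pselect (forall x, x \in s -> exists2 y, y \in t &
    normc u * normc (v - y) <= normc (u - x) * normc y).
  apply/orP; left.
  rewrite -[(\prod_(x <- s) maxc1 x) ^+ _]prodrXl -!(prodr_const_seq s) -!big_split /=.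
  apply: ler_prod_seq => x xs.
  rewrite prodr_ge0 /=; last by move=> *; exact: normc_ge0.
  have [y yt le] := P x xs; apply: (le_trans (prod_dist_left yt le)).
  by rewrite [normc _ * _]mulrC.
have {}Q y : y \in t -> normc (u - x0) * normc y < normc u * normc (v - y).
  by move=> yt; rewrite ltNge; apply/negP => le; apply: Q; exists y.
(* The single point [x0] supplies the product of the |v - y|; the remaining points of [s] take the
   crude bound [prod_dist]. *)
apply/orP; right.
rewrite -[(\prod_(x <- s) maxc1 x) ^+ _]prodrXl !(big_rem x0 x0s) /=.
have s0 : (0 < size s)%N by case: (s) x0s.
rewrite -[in leRHS](prednK s0) /= -(size_rem x0s) exprS.
set V := \prod_(y <- t) normc (v - y).
have V0 : 0 <= V by apply: prodr_ge0 => *; exact: normc_ge0.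
apply: (@le_trans _ _ (K ^+ size t * V *
    \prod_(x <- rem x0 s) (K ^+ size t * (maxc1 x ^+ size t * \prod_(y <- t) maxc1 y)))).
  apply: ler_pM; rewrite ?prodr_ge0 //.
  - by move=> *; exact: normc_ge0.
  - by move=> *; apply: prodr_ge0 => *; exact: normc_ge0.
  - exact: prod_dist_right.
  - apply: ler_prod_seq => x _; rewrite prod_dist andbT.
    by apply: prodr_ge0 => *; exact: normc_ge0.
rewrite !big_split /= !prodr_const_seq.
set C := _ ^+ size (rem _ _); set D := _ ^+ size (rem _ _); set B := \prod_(_ <- _) _.
(* The estimate at [x0] contains no power of [maxc1 x0]; the one in the target can be inserted
   because it is at least 1. *)
have x1 : 1 <= maxc1 x0 ^+ size t by rewrite exprn_ege1 // maxc1_ge1.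
have W0 : 0 <= K ^+ size t * V * (C * (B * D)).
  rewrite !mulr_ge0 // ?exprn_ge0 // prodr_ge0 // => *.
  by rewrite exprn_ge0 // maxc1_ge0.
apply: (le_trans (ler_peMr W0 x1)); rewrite le_eqVlt; apply/orP; left; apply/eqP; ring.
Qed.

End ProductDistance.

(** * Finite-level estimates for values and heights, and their roots of order D * E *)

Section BoxtimesValue.
Variable R : realType.
Implicit Types (f g p : {poly int}).
Local Notation peval p t := ((map_poly intr p).[t : R]).

(** A closed form that satisfies the three inequalities of [K_bounds] and depends on the evaluation
    points only. *)
Definition box_const (u v : R) : R := 2 * (1 + `|u|) * (1 + `|v|).

Lemma box_const_ge1 u v : 1 <= box_const u v.
Proof. rewrite /box_const; have := normr_ge0 u; have := normr_ge0 v; nra. Qed.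

Lemma norm_horner_boxtimes_le f g (u v : R) : (0 < deg f)%N -> (0 < deg g)%N ->
  `|peval (boxtimes R f g) (u * v)| <=
  box_const u v ^+ (deg f * deg g) * Num.max
    (mahler R f ^+ (deg g).-1 * mahler R g ^+ deg f * `|peval f u|)
    (mahler R f ^+ deg g * mahler R g ^+ (deg f).-1 * `|peval g v|).
Proof.
move=> df dg.
have f0 : f != 0 by apply: contraTneq df => ->; rewrite /deg size_poly0.
have g0 : g != 0 by apply: contraTneq dg => ->; rewrite /deg size_poly0.
rewrite norm_horner_boxtimes // rmorphM /=.
have KE : [/\ 2 <= box_const u v, 2 * Normc.normc u%:C%C <= box_const u v &
    1 + Normc.normc u%:C%C * Normc.normc v%:C%C <= box_const u v].
  by rewrite !normc_real /box_const; split; have := normr_ge0 u; have := normr_ge0 v; nra.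
have := prod_prod_dist_le KE (croots R f) (croots R g).
rewrite !size_croots // => /(ler_wpM2l _) le.
apply: (le_trans (le _ _)); first by rewrite mulr_ge0 ?exprn_ge0.
rewrite [leLHS]mulrCA ler_wpM2l ?exprn_ge0 ?(le_trans _ (box_const_ge1 u v)) //.
rewrite maxr_pMr ?mulr_ge0 ?exprn_ge0 // !norm_horner !mahlerE !exprMn.
have -> : forall a b c d : R, a = c -> b = d -> (Num.max a b <= Num.max c d) = true.
  by move=> a b c d -> ->; rewrite lexx.
- by [].
(* One factor |a| of |a|^n, with a the leading coefficient of [f], completes the product of the |u -
   x| to |f(u)|; this needs n = deg g > 0. The next case is symmetric. *)
- by case: (deg g) dg => // n _; rewrite !exprS /=; ring.
- by case: (deg f) df => // m _; rewrite !exprS /=; ring.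
Qed.

Lemma powR_invnX (x : R) n : 0 <= x -> (0 < n)%N -> (x `^ n%:R^-1) ^+ n = x.
Proof.
move=> x0 n0; rewrite -powR_mulrn ?powR_ge0 // -powRrM mulVf ?powRr1 //.
by rewrite pnatr_eq0 -lt0n.
Qed.

Lemma powR_1BinvnX (x : R) n : 0 <= x -> (0 < n)%N ->
  (x `^ (1 - n%:R^-1)) ^+ n = x ^+ n.-1.
Proof.
move=> x0 n0; rewrite -!powR_mulrn ?powR_ge0 // -powRrM mulrBl mul1r mulVf.
  by rewrite -[X in _ - X]/(1%:R) -natrB // subn1.
by rewrite pnatr_eq0 -lt0n.
Qed.

Lemma powR_invn_le (x y : R) n : 0 <= x -> 0 <= y -> (0 < n)%N ->
  x <= y ^+ n -> x `^ n%:R^-1 <= y.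
Proof.
move=> x0 y0 n0 xy; rewrite -(@ler_pXn2r _ n) ?nnegrE ?powR_ge0 //.
by rewrite powR_invnX.
Qed.

(** One component of a summand in the tropical bound: a and b are Mahler measures and x is the
    absolute value of the polynomial measured by a. The other summand exchanges the roles of the two
    polynomials and of D and E. *)
Definition decay_term (a b x : R) (D E : nat) : R :=
  (a `^ D%:R^-1) `^ (1 - E%:R^-1) * b `^ E%:R^-1 * (x `^ D%:R^-1) `^ E%:R^-1.

Lemma decay_term_ge0 a b x D E : 0 <= decay_term a b x D E.
Proof. by rewrite /decay_term !mulr_ge0 ?powR_ge0. Qed.

Lemma decay_termX a b x D E : 0 <= a -> 0 <= b -> 0 <= x -> (0 < D)%N -> (0 < E)%N ->
  decay_term a b x D E ^+ (D * E) = a ^+ E.-1 * b ^+ D * x.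
Proof.
move=> a0 b0 x0 D0 E0; rewrite mulnC exprM !exprMn.
rewrite powR_1BinvnX ?powR_ge0 // [(b `^ _) ^+ _]powR_invnX // powR_invnX ?powR_ge0 //.
by rewrite exprAC !powR_invnX.
Qed.

(** After raising to the power D * E this is [norm_horner_boxtimes_le] with the degrees replaced by
    their bounds D and E. The replacement only enlarges the right side, since [box_const] and both
    Mahler measures are at least 1. *)
Lemma boxtimes_root_le f g (u v : R) D E :
  (0 < deg f <= D)%N -> (0 < deg g <= E)%N ->
  `|peval (boxtimes R f g) (u * v)| `^ (D * E)%:R^-1 <=
  box_const u v * Num.max (decay_term (mahler R f) (mahler R g) `|peval f u| D E)
                          (decay_term (mahler R g) (mahler R f) `|peval g v| E D).
Proof.
move=> /andP[f0 fD] /andP[g0 gE].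
have D0 : (0 < D)%N by exact: leq_trans fD.
have E0 : (0 < E)%N by exact: leq_trans gE.
have K1 := box_const_ge1 u v; have K0 : 0 <= box_const u v by exact: le_trans K1.
have mf : 1 <= mahler R f.
  by apply: mahler_ge1; apply: contraTneq f0 => ->; rewrite /deg size_poly0.
have mg : 1 <= mahler R g.
  by apply: mahler_ge1; apply: contraTneq g0 => ->; rewrite /deg size_poly0.
have mono (a b : R) k l k' l' : 1 <= a -> 1 <= b -> (k <= k')%N -> (l <= l')%N ->
    a ^+ k * b ^+ l <= a ^+ k' * b ^+ l'.
  by move=> a1 b1 kk ll; rewrite ler_pM ?exprn_ge0 ?ler_weXn2l // (le_trans _ a1, le_trans _ b1).
have A0 := decay_term_ge0 (mahler R f) (mahler R g) `|peval f u| D E.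
have B0 := decay_term_ge0 (mahler R g) (mahler R f) `|peval g v| E D.
have AE : decay_term (mahler R f) (mahler R g) `|peval f u| D E ^+ (D * E) =
    mahler R f ^+ E.-1 * mahler R g ^+ D * `|peval f u|.
  by rewrite decay_termX ?mahler_ge0.
have BE : decay_term (mahler R g) (mahler R f) `|peval g v| E D ^+ (D * E) =
    mahler R f ^+ E * mahler R g ^+ D.-1 * `|peval g v|.
  by rewrite mulnC decay_termX ?mahler_ge0 // [_ ^+ E * _]mulrC.
move: (decay_term (mahler R f) _ _ _ _) (decay_term (mahler R g) _ _ _ _) A0 B0 AE BE.
move=> A B A0 B0 AE BE.
have AB0 : 0 <= Num.max A B by rewrite le_max A0.
apply: powR_invn_le => //; first exact: mulr_ge0; first by rewrite muln_gt0 D0.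
apply: (le_trans (norm_horner_boxtimes_le _ _ f0 g0)).
rewrite [leRHS]exprMn; apply: ler_pM.
- exact: exprn_ge0.
- by rewrite le_max !mulr_ge0 ?exprn_ge0 ?mahler_ge0.
- by rewrite ler_weXn2l // leq_mul.
rewrite ge_max; apply/andP; split.
  apply: (@le_trans _ _ (A ^+ (D * E))); last by rewrite lerXn2r ?nnegrE // le_max lexx.
  by rewrite AE ler_wpM2r // mono // -!subn1 leq_sub2r.
apply: (@le_trans _ _ (B ^+ (D * E))); last by rewrite lerXn2r ?nnegrE // le_max lexx orbT.
by rewrite BE ler_wpM2r // mono // -!subn1 leq_sub2r.
Qed.

Lemma mahler_root_le f D : (0 < D)%N -> (deg f <= D)%N ->
  mahler R f `^ D%:R^-1 <= 2 * (height f)%:R `^ D%:R^-1.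
Proof.
move=> D0 fD; apply: powR_invn_le; rewrite ?mahler_ge0 ?mulr_ge0 ?powR_ge0 //.
rewrite exprMn powR_invnX //; apply: (le_trans (mahler_le_height _ _)).
by rewrite ler_wpM2r // ler_weXn2l // ler1n.
Qed.

Lemma height_boxtimes_root_le f g D E : f != 0 -> g != 0 ->
  (0 < D)%N -> (0 < E)%N -> (deg f <= D)%N -> (deg g <= E)%N ->
  (height (boxtimes R f g))%:R `^ (D * E)%:R^-1 <=
  8 * ((height f)%:R `^ D%:R^-1 * (height g)%:R `^ E%:R^-1) :> R.
Proof.
move=> f0 g0 D0 E0 fD gE.
(* One factor 2 comes from [height_boxtimes_le], and one from each passage from Mahler measure to
   height. *)
have -> : 8 * ((height f)%:R `^ D%:R^-1 * (height g)%:R `^ E%:R^-1) =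
  2 * ((2 * (height f)%:R `^ D%:R^-1) * (2 * (height g)%:R `^ E%:R^-1)) :> R by ring.
apply: (@le_trans _ _ (2 * (mahler R f `^ D%:R^-1 * mahler R g `^ E%:R^-1))); last first.
  by rewrite ler_wpM2l // ler_pM ?powR_ge0 ?mahler_root_le.
apply: powR_invn_le; rewrite ?mulr_ge0 ?powR_ge0 ?muln_gt0 ?D0 //.
apply: (le_trans (height_boxtimes_le _ f0 g0)).
rewrite [leRHS]exprMn [X in _ <= _ * X]exprMn.
apply: ler_pM; rewrite ?mulr_ge0 ?exprn_ge0 ?mahler_ge0 //.
  by rewrite ler_weXn2l ?ler1n // leq_mul.
rewrite [X in _ <= X * _]exprM mulnC [X in _ <= _ * X]exprM !powR_invnX ?mahler_ge0 //.
by rewrite ler_pM ?exprn_ge0 ?mahler_ge0 // ler_weXn2l ?mahler_ge1.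
Qed.

End BoxtimesValue.

(** * Order and operations on projective classes in terms of representing sequences *)

Section ProjectiveClasses.
Variables (R : realType) (U : npultra).
Implicit Types (x y r : nat -> R) (F G : nat -> {poly int}) (D E : nat -> nat).
Local Notation peval p t := ((map_poly intr p).[t : R]).
Local Notation cls x := (PRcls (seqcls U x)).

Lemma fin_pos_unit_sconst (c : R) : 0 < c -> fin_pos_unit (sconst U c).
Proof.
move=> c0; apply/fin_pos_unit_cls; exists (c + c^-1); first by rewrite addr_gt0 ?invr_gt0.
apply: filterS filterT => i _ /=; rewrite lerDl invr_ge0 (ltW c0) andbT.
by rewrite invf_ple ?posrE ?addr_gt0 ?invr_gt0 // lerDr ltW.
Qed.

(** Changing representatives multiplies by units bounded above and below by positive reals, so the
    order on classes is inequality up to a real constant. *)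
Lemma PRle_cls x y : npu U [set i | 0 <= x i] -> npu U [set i | 0 <= y i] ->
  PRle (cls x) (cls y) <-> exists2 C, 0 < C & npu U [set i | x i <= C * y i].
Proof.
move=> x0 y0; split=> [[x' [y' [x'0 y'0]]]|[C C0 xy]].
  move=> /PRcls_eq[||u] //; first exact/srel_cls.
  rewrite -(seqcls_repr u) => /fin_pos_unit_cls[M M0 uM] ->.
  move=> /PRcls_eq[||v] //; first exact/srel_cls.
  rewrite -(seqcls_repr v) => /fin_pos_unit_cls[N N0 vN] ->.
  rewrite /smul !smap2_cls => /srel_cls xy.
  exists (M * N); first exact: mulr_gt0.
  apply: filterS3 (filterI x0 y0) (filterI uM vN) xy => i /=.
  move=> [x0i y0i] [/andP[uMi _] /andP[_ vNi]] xyi.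
  rewrite -mulrA -ler_pdivrMl //.
  apply: (le_trans (ler_wpM2r x0i uMi)); apply: (le_trans xyi).
  exact: ler_wpM2r.
exists (seqcls U x), (smul (sconst U C) (seqcls U y)).
have Cy0 : sle (sconst U 0) (smul (sconst U C) (seqcls U y)).
  by apply: smul_ge0; apply/srel_cls => //; apply: filterS filterT => i _ /=; exact: ltW.
split=> //; first exact/srel_cls.
  apply/PRcls_eq => //; first exact/srel_cls.
  by exists (sconst U C) => //; exact: fin_pos_unit_sconst.
by rewrite /smul smap2_cls; apply/srel_cls.
Qed.

Lemma PRle_cls_anti x y : npu U [set i | 0 <= x i] -> npu U [set i | 0 <= y i] ->
  PRle (cls x) (cls y) -> PRle (cls y) (cls x) -> cls x = cls y.
Proof.
move=> x0 y0 /PRle_cls[] // A A0 xy /PRle_cls[] // B B0 yx.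
apply/PRcls_eq; [exact/srel_cls|exact/srel_cls|].
(* The unit is the quotient y / x; where x vanishes so does y, by y <= B x, and any unit value will
   do. *)
exists (seqcls U (fun i => if x i == 0 then 1 else y i / x i)); last first.
  rewrite /smul smap2_cls; apply/seqcls_eq; apply: filterS2 y0 yx => i /= y0i.
  have [->|xi] := eqVneq; last by rewrite divfK.
  by rewrite !mulr0 => yi; apply/eqP; rewrite eq_le yi.
apply/fin_pos_unit_cls; exists (1 + A + B); first by rewrite !addr_gt0.
have M1 : 1 <= 1 + A + B by lra.
have M0 : 0 < 1 + A + B by exact: lt_le_trans M1.
apply: filterS3 x0 xy yx => i /= x0i xyi yxi.
have [_|xi] := eqVneq; first by rewrite invf_le1 // M1.
have {x0i xi}xi : 0 < x i by rewrite lt_neqAle eq_sym xi.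
rewrite ler_pdivrMr // ler_pdivlMr // ler_pdivrMl //.
have yi : 0 <= y i by nra.
by apply/andP; split; nra.
Qed.

(** If the inequality failed for some C, the ultrafilter would give y <= C x almost everywhere, and
    antisymmetry would identify the classes. *)
Lemma PRlt_cls x y : npu U [set i | 0 <= x i] -> npu U [set i | 0 <= y i] ->
  PRlt (cls x) (cls y) <-> forall C, 0 < C -> npu U [set i | C * x i < y i].
Proof.
move=> x0 y0; split=> [[xy ne] C C0|lt].
  apply: contrapT => /ultraN yx; apply: ne; apply: PRle_cls_anti => //.
  apply/PRle_cls => //; exists C => //; apply: filterS yx => i /= /negP.
  by rewrite -leNgt.
split; first by apply/PRle_cls => //; exists 1 => //; apply: filterS (lt 1 ltr01) => i /=;
  rewrite !mul1r; exact: ltW.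
move=> eq; have : PRle (cls y) (cls x).
  by rewrite eq; apply/PRle_cls => //; exists 1 => //; apply: filterS filterT => i _ /=;
    rewrite mul1r.
move=> /PRle_cls[] // C C0 yx; apply: (@filter_not_empty _ (npu U)).
by apply: filterS2 yx (lt C C0) => i /= yxi; rewrite ltNge yxi.
Qed.

(** If y <= A z then max(y, z) <= (1 + A) z. If the class of y is not below that of z, then z < y
    almost everywhere and the maximum is y. *)
Lemma PRle_add_cls x y z (C : R) : 0 < C -> npu U [set i | 0 <= x i] ->
  npu U [set i | 0 <= y i] -> npu U [set i | 0 <= z i] ->
  npu U [set i | x i <= C * Num.max (y i) (z i)] ->
  PRle (cls x) (PRadd (cls y) (cls z)).
Proof.
move=> C0 x0 y0 z0 le; rewrite /PRadd; case: asboolP => [/PRle_cls[] // A A0 yz|].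
  apply/PRle_cls => //; exists (C * (1 + A)); first by rewrite mulr_gt0 ?addr_gt0.
  apply: filterS3 z0 yz le => i /= z0i yzi /le_trans; apply.
  by rewrite -mulrA ler_pM2l // ge_max; apply/andP; split; nra.
move=> nyz; have /ultraN zy : ~ npu U [set i | y i <= 1 * z i].
  by move=> yz; apply: nyz; apply/PRle_cls => //; exists 1.
apply/PRle_cls => //; exists C => //; apply: filterS2 zy le => i /= /negP.
by rewrite mul1r -ltNge => /ltW/max_l ->.
Qed.

Lemma PRmul_seq x y : npu U [set i | 0 <= x i] -> npu U [set i | 0 <= y i] ->
  PRmul (cls x) (cls y) = cls (fun i => x i * y i).
Proof. by move=> x0 y0; rewrite PRmul_cls ?/smul ?smap2_cls //; exact/srel_cls. Qed.

Lemma PRpow_seq x r : npu U [set i | 0 <= x i] -> npu U [set i | 0 <= r i <= 1] ->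
  PRpow (cls x) (seqcls U r) = cls (fun i => x i `^ r i).
Proof.
move=> x0 r01; rewrite PRpow_cls ?/spow ?smap2_cls //; first exact/srel_cls.
  by apply/srel_cls; apply: filterS r01 => i /= /andP[].
move=> /(_ 1); rewrite /sabs smap_cls => /srel_cls r1; apply: (@filter_not_empty _ (npu U)).
by apply: filterS2 r01 r1 => i /= /andP[r0 r1]; rewrite ger0_norm // ltNge r1.
Qed.

Lemma decay_cls D t F : decay (seqcls U D) t (seqcls U F) =
  cls (fun i => `|peval (F i) t| `^ (D i)%:R^-1).
Proof. by rewrite /decay /seval smap_cls /sabs smap_cls /sinvn smap_cls /spow smap2_cls. Qed.

Lemma growth_cls D F : growth R (seqcls U D) (seqcls U F) =
  cls (fun i => (height (F i))%:R `^ (- (D i)%:R^-1)).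
Proof. by rewrite /growth /sheight smap_cls /sinvn smap_cls /sopp smap_cls /spow smap2_cls. Qed.

Lemma mahlerd_cls D F : mahlerd R (seqcls U D) (seqcls U F) =
  seqcls U (fun i => mahler R (F i) `^ (D i)%:R^-1).
Proof. by rewrite /mahlerd /smahler smap_cls /sinvn smap_cls /spow smap2_cls. Qed.

Lemma Zvan_cls t F : Zvan t (seqcls U F) <->
  forall a, 0 < a -> npu U [set i | `|peval (F i) t| < a].
Proof.
rewrite /Zvan /= /infclose /infinitesimal /seval smap_cls /ssub smap2_cls /sabs smap_cls.
by split=> H a /H => [/srel_cls|lt]; [|apply/srel_cls; move: lt]; apply: filterS => i /=;
  rewrite subr0.
Qed.

Lemma invn_bounds n : 0 <= (n%:R^-1 : R) <= 1.
Proof.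
(* The inverse of 0 is 0, so the bounds hold at n = 0 too. *)
rewrite invr_ge0 ler0n /=; case: n => [|n]; first by rewrite invr0.
by rewrite invf_le1 // ler1n.
Qed.

Lemma onem_invn_bounds n : 0 <= (1 - n%:R^-1 : R) <= 1.
Proof. by have /andP[] := invn_bounds n; lra. Qed.

Lemma decay_term_cls_left D E F G t :
  PRact (smul (spow (mahlerd R (seqcls U D) (seqcls U F)) (s1Binvn R (seqcls U E)))
              (mahlerd R (seqcls U E) (seqcls U G)))
        (PRpow (decay (seqcls U D) t (seqcls U F)) (sinvn R (seqcls U E))) =
  cls (fun i => decay_term (mahler R (F i)) (mahler R (G i)) `|peval (F i) t| (D i) (E i)).
Proof.
rewrite !mahlerd_cls decay_cls /sinvn smap_cls /s1Binvn smap_cls /spow smap2_cls /smul smap2_cls.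
by rewrite PRpow_seq /PRact ?PRmul_seq //; apply: filterE => i /=;
  rewrite ?mulr_ge0 ?powR_ge0 ?invn_bounds.
Qed.

Lemma decay_term_cls_right D E F G t :
  PRact (smul (mahlerd R (seqcls U D) (seqcls U F))
              (spow (mahlerd R (seqcls U E) (seqcls U G)) (s1Binvn R (seqcls U D))))
        (PRpow (decay (seqcls U E) t (seqcls U G)) (sinvn R (seqcls U D))) =
  cls (fun i => decay_term (mahler R (G i)) (mahler R (F i)) `|peval (G i) t| (E i) (D i)).
Proof.
rewrite -decay_term_cls_left !mahlerd_cls /s1Binvn smap_cls /spow smap2_cls /smul !smap2_cls.
congr (PRact _ _); apply/seqcls_eq; apply: filterE => i /=.
by rewrite mulrC.
Qed.

Lemma decay_boxtimes_cls D E t F G :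
  decay (smuln (seqcls U D) (seqcls U E)) t (sboxtimes R (seqcls U F) (seqcls U G)) =
  cls (fun i => `|peval (boxtimes R (F i) (G i)) t| `^ (D i * E i)%:R^-1).
Proof. by rewrite /smuln smap2_cls /sboxtimes smap2_cls decay_cls. Qed.

Lemma decay_boxtimes_le (theta eta : R) (d e : star U nat) (f g : star U {poly int}) :
  sle (sdeg f) d -> sle (sdeg g) e ->
  sle (sconst U 1%N) (sdeg f) -> sle (sconst U 1%N) (sdeg g) ->
  PRle (decay (smuln d e) (theta * eta) (sboxtimes R f g))
    (PRadd
      (PRact (smul (spow (mahlerd R d f) (s1Binvn R e)) (mahlerd R e g))
             (PRpow (decay d theta f) (sinvn R e)))
      (PRact (smul (mahlerd R d f) (spow (mahlerd R e g) (s1Binvn R d)))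
             (PRpow (decay e eta g) (sinvn R d)))).
Proof.
rewrite -(seqcls_repr d) -(seqcls_repr e) -(seqcls_repr f) -(seqcls_repr g).
move: (repr d) (repr e) (repr f) (repr g) => D E F G.
rewrite /sdeg !smap_cls => /srel_cls FD /srel_cls GE /srel_cls F0 /srel_cls G0.
rewrite decay_boxtimes_cls decay_term_cls_left decay_term_cls_right.
apply: (@PRle_add_cls _ _ _ (box_const theta eta)).
- exact: lt_le_trans (box_const_ge1 _ _).
- by apply: filterE => i; exact: powR_ge0.
- by apply: filterE => i; exact: decay_term_ge0.
- by apply: filterE => i; exact: decay_term_ge0.
apply: filterS2 (filterI FD GE) (filterI F0 G0) => i /= [FDi GEi] [F0i G0i].
by apply: boxtimes_root_le; apply/andP.
Qed.

(** A nonzero integer has absolute value at least 1. This provides the positive degrees for the map,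
    whose domain only asks for infinitesimal values. *)
Lemma deg_gt0_eval_lt1 p (t : R) : p != 0 -> `|peval p t| < 1 -> (0 < deg p)%N.
Proof.
move=> p0; case: posnP => // dp; rewrite ltNge => /negP[].
have sp : (size p <= 1)%N by rewrite -subn_eq0 subn1 -/(deg p) dp.
rewrite (size1_polyC sp) map_polyC hornerC -intr_norm ler1z -gtz0_ge1 normr_gt0.
by apply: contraNneq p0 => c0; rewrite (size1_polyC sp) c0.
Qed.

Lemma height_gt0 p : p != 0 -> (0 < height p)%N.
Proof.
move=> p0; apply: leq_trans (coef_le_height p (size p).-1).
by rewrite absz_gt0 -lead_coefE lead_coef_eq0.
Qed.

(** Settles the products with a zero factor, which are 0 by the convention in [boxtimes]. *)
Lemma Zgrow0 (m : PR U R) t d : Zgrow m t d (sconst U 0).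
Proof.
split=> //; first by apply/Zvan_cls => a a0; apply: filterE => i /=; rewrite rmorph0 horner0 normr0.
rewrite -(seqcls_repr d) /sdeg smap_cls; apply/srel_cls; apply: filterE => i /=.
by rewrite /deg size_poly0.
Qed.

Lemma seqcls_neq0 F : seqcls U F <> sconst U 0 <-> npu U [set i | F i != 0].
Proof.
split=> [F0|F0 /seqcls_eq F0'].
  have /ultraN : ~ npu U [set i | F i = 0] by move=> F0'; apply: F0; apply/seqcls_eq.
  by apply: filterS => i /= /eqP.
apply: (@filter_not_empty _ (npu U)); apply: filterS2 F0 F0' => i /= + E.
by rewrite E eqxx.
Qed.

Lemma mahler_growth_infinitesimal x D F :
  npu U [set i | 0 < x i] -> npu U [set i | 0 < D i]%N ->
  npu U [set i | F i != 0] -> npu U [set i | deg (F i) <= D i]%N ->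
  PRlt (cls x) (growth R (seqcls U D) (seqcls U F)) ->
  forall a, 0 < a -> npu U [set i | mahler R (F i) `^ (D i)%:R^-1 * x i < a].
Proof.
move=> x0 D0 F0 FD; rewrite growth_cls => lt a a0.
(* With this constant the growth condition reads 2 h^(1/D) x < a, h being the height, and the left
   side dominates m(F)^(1/D) x by [mahler_root_le]. *)
move/PRlt_cls: lt => /(_ _ _ (2 / a)) lt.
have {lt} : npu U [set i | 2 / a * x i < (height (F i))%:R `^ (- (D i)%:R^-1)].
  apply: lt; last by rewrite divr_gt0.
    by apply: filterS x0 => i /=; exact: ltW.
  by apply: filterE => i; exact: powR_ge0.
apply: filterS3 (filterI x0 D0) (filterI F0 FD) => i /= [x0i D0i] [F0i FDi] lt.
have h0 : 0 < (height (F i))%:R `^ (D i)%:R^-1 :> R.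
  by rewrite powR_gt0 // ltr0n height_gt0.
apply: (@le_lt_trans _ _ (2 * (height (F i))%:R `^ (D i)%:R^-1 * x i)).
  by rewrite ler_wpM2r ?(ltW x0i) // mahler_root_le.
move: lt; rewrite powRN -[X in _ < X]mul1r ltr_pdivlMr //.
rewrite mulrAC -mulrA mulrAC ltr_pdivrMr // mul1r => lt.
by apply: le_lt_trans lt; rewrite le_eqVlt; apply/orP; left; apply/eqP; ring.
Qed.

(** The power of p allowed by the decay bound has the same exponent 1 - 1/E as a^(1/D) in
    [decay_term]. Together they form a power of a^(1/D) * p <= 1 and drop out. *)
Lemma decay_term_le (a b x C p q : R) (D E : nat) : 0 <= a -> 0 <= b -> 0 < p -> 0 <= q ->
  0 <= C -> a `^ D%:R^-1 * p <= 1 ->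
  (x `^ D%:R^-1) `^ E%:R^-1 <= C * (p `^ (1 - E%:R^-1) * q) ->
  decay_term a b x D E <= C * (b `^ E%:R^-1 * q).
Proof.
move=> a0 b0 p0 q0 C0 ap le; rewrite /decay_term.
have {}ap : (a `^ D%:R^-1) `^ (1 - E%:R^-1) * p `^ (1 - E%:R^-1) <= 1.
  rewrite -powRM ?powR_ge0 ?(ltW p0) //.
  apply: le_trans (_ : _ <= 1 `^ (1 - E%:R^-1)) _; last by rewrite powR1.
  rewrite ge0_ler_powR ?nnegrE ?mulr_ge0 ?powR_ge0 ?(ltW p0) //.
  by have /andP[] := onem_invn_bounds E.
apply: (le_trans (ler_wpM2l _ le)); first by rewrite mulr_ge0 ?powR_ge0.
set w := _ `^ (1 - _) in ap *; set z := p `^ _ in ap *; set v := b `^ _.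
have -> : w * v * (C * (z * q)) = (w * z) * (C * (v * q)) by ring.
by rewrite -[leRHS]mul1r ler_wpM2r ?mulr_ge0 ?powR_ge0.
Qed.

End ProjectiveClasses.

(** * The resultant product as a map between the growth-decay sets *)

Section BoxtimesMap.
Variables (R : realType) (U : npultra).
Implicit Types (x y : nat -> R) (F G : nat -> {poly int}) (D E : nat -> nat).
Local Notation peval p t := ((map_poly intr p).[t : R]).
Local Notation cls x := (PRcls (seqcls U x)).

Lemma PRmulC : commutative (@PRmul U R).
Proof.
move=> m n; rewrite /PRmul /smul; congr PRcls; apply/seqcls_eq.
by apply: filterE => i /=; rewrite mulrC.
Qed.

Lemma decay_le_seq x y D E F t : npu U [set i | 0 < x i] -> npu U [set i | 0 < y i] ->
  PRle (PRpow (decay (seqcls U D) t (seqcls U F)) (sinvn R (seqcls U E)))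
       (PRmul (PRpow (cls x) (s1Binvn R (seqcls U E))) (cls y)) ->
  exists2 C, 0 < C & npu U [set i |
    (`|peval (F i) t| `^ (D i)%:R^-1) `^ (E i)%:R^-1 <= C * (x i `^ (1 - (E i)%:R^-1) * y i)].
Proof.
move=> x0 y0; rewrite decay_cls /sinvn smap_cls /s1Binvn smap_cls.
have {}x0 : npu U [set i | 0 <= x i] by apply: filterS x0 => i /=; exact: ltW.
have {}y0 : npu U [set i | 0 <= y i] by apply: filterS y0 => i /=; exact: ltW.
have z0 : npu U [set i | 0 <= x i `^ (1 - (E i)%:R^-1)].
  by apply: filterE => i; exact: powR_ge0.
rewrite PRpow_seq; last 2 first.
- by apply: filterE => i; exact: powR_ge0.
- by apply: filterE => i; exact: invn_bounds.
rewrite PRpow_seq //; last by apply: filterE => i; exact: onem_invn_bounds.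
rewrite PRmul_seq // => /PRle_cls; apply.
- by apply: filterE => i; exact: powR_ge0.
- by apply: filterS2 z0 y0 => i /=; exact: mulr_ge0.
Qed.

Lemma Zvan_boxtimes x y D E F G theta eta (Cf Cg : R) : 0 < Cf -> 0 < Cg ->
  npu U [set i | 0 < x i] -> npu U [set i | 0 < y i] ->
  npu U [set i | 0 < deg (F i) <= D i]%N -> npu U [set i | 0 < deg (G i) <= E i]%N ->
  (forall a, 0 < a -> npu U [set i | mahler R (F i) `^ (D i)%:R^-1 * x i < a]) ->
  (forall a, 0 < a -> npu U [set i | mahler R (G i) `^ (E i)%:R^-1 * y i < a]) ->
  npu U [set i | (`|peval (F i) theta| `^ (D i)%:R^-1) `^ (E i)%:R^-1 <=
    Cf * (x i `^ (1 - (E i)%:R^-1) * y i)] ->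
  npu U [set i | (`|peval (G i) eta| `^ (E i)%:R^-1) `^ (D i)%:R^-1 <=
    Cg * (y i `^ (1 - (D i)%:R^-1) * x i)] ->
  Zvan (theta * eta) (seqcls U (fun i => boxtimes R (F i) (G i))).
Proof.
move=> Cf0 Cg0 x0 y0 FD GE mF mG dF dG; apply/Zvan_cls => a a0.
(* The order D * E of the root may be infinite, so the root is made smaller than both a and 1: its
   power of order D * E >= 1 then stays below a. The number [c] below is chosen so that K (Cf + Cg)
   c <= b, and c <= 1 as [decay_term_le] requires. *)
pose K := box_const theta eta; pose b := Num.min a 1.
have K0 : 0 < K by exact: lt_le_trans (box_const_ge1 _ _).
have b0 : 0 < b by rewrite lt_min a0 ltr01.
pose c := Num.min 1 (b / (K * (Cf + Cg))).
have S0 : 0 < K * (Cf + Cg) := mulr_gt0 K0 (addr_gt0 Cf0 Cg0).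
have c0 : 0 < c by rewrite lt_min ltr01 divr_gt0.
have cb : K * ((Cf + Cg) * c) <= b.
  rewrite mulrA mulrC -ler_pdivlMr //.
  by rewrite ge_min lexx orbT.
apply: filterS3 (filterI (filterI x0 y0) (filterI FD GE)) (filterI (mF c c0) (mG c c0))
  (filterI dF dG) => i /= [[xi yi] [FDi GEi]] [mFi mGi] [dFi dGi].
have c1 : c <= 1 by rewrite ge_min lexx.
have mF0 := mahler_ge0 R (F i); have mG0 := mahler_ge0 R (G i).
have := boxtimes_root_le theta eta FDi GEi.
have tF := decay_term_le mF0 mG0 xi (ltW yi) (ltW Cf0) (le_trans (ltW mFi) c1) dFi.
have tG := decay_term_le mG0 mF0 yi (ltW xi) (ltW Cg0) (le_trans (ltW mGi) c1) dGi.
set A := decay_term _ _ _ _ _ in tF *; set B := decay_term _ _ _ _ _ in tG *.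
have {tF}tF : A < (Cf + Cg) * c.
  apply: (le_lt_trans tF); rewrite mulrDl -[ltLHS]addr0 ltr_leD ?ltr_pM2l //.
  by rewrite mulr_ge0 ?ltW.
have {tG}tG : B < (Cf + Cg) * c.
  apply: (le_lt_trans tG); rewrite mulrDl addrC -[ltLHS]addr0 ltr_leD ?ltr_pM2l //.
  by rewrite mulr_ge0 ?ltW.
set r := _ `^ _ => rAB.
have rb : r < b.
  apply: (le_lt_trans rAB); apply: lt_le_trans cb.
  by rewrite ltr_pM2l // gt_max tF tG.
have N0 : (0 < D i * E i)%N.
  move: FDi GEi => /andP[F0 FD'] /andP[G0 GE'].
  by rewrite muln_gt0 (leq_trans F0) // (leq_trans G0).
rewrite -(@powR_invnX _ `|_| (D i * E i)) // -/r.
have r0 : 0 <= r by exact: powR_ge0.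
have [ba b1] : b <= a /\ b <= 1 by rewrite !ge_min !lexx orbT.
apply: le_lt_trans (lt_le_trans rb ba).
rewrite -[leRHS]expr1 ler_wiXn2l // (le_trans (ltW rb)) //.
Qed.

Lemma growth_boxtimes_gt x y D E F G :
  npu U [set i | 0 < x i] -> npu U [set i | 0 < y i] ->
  npu U [set i | 0 < deg (F i) <= D i]%N -> npu U [set i | 0 < deg (G i) <= E i]%N ->
  PRlt (cls x) (growth R (seqcls U D) (seqcls U F)) ->
  PRlt (cls y) (growth R (seqcls U E) (seqcls U G)) ->
  PRlt (cls (fun i => x i * y i))
    (growth R (seqcls U (fun i => D i * E i)%N) (seqcls U (fun i => boxtimes R (F i) (G i)))).
Proof.
move=> x0 y0 FD GE; rewrite !growth_cls.
have x0' : npu U [set i | 0 <= x i] by apply: filterS x0 => i /=; exact: ltW.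
have y0' : npu U [set i | 0 <= y i] by apply: filterS y0 => i /=; exact: ltW.
have pos (z s : nat -> R) : npu U [set i | 0 <= z i `^ s i].
  by apply: filterE => i; exact: powR_ge0.
move=> /PRlt_cls-/(_ x0' (pos _ _)) lF /PRlt_cls-/(_ y0' (pos _ _)) lG.
apply/PRlt_cls => //; first by apply: filterS2 x0' y0' => i /=; exact: mulr_ge0.
(* Both C and the 8 of [height_boxtimes_root_le] are charged to the growth of F; for G the constant
   1 suffices. *)
move=> C C0; have C8 : 0 < 8 * C by rewrite mulr_gt0.
apply: filterS3 (filterI (filterI x0 y0) (filterI FD GE)) (lF _ C8) (lG _ ltr01).
move=> i /= [[xi yi] [/andP[F0 FDi] /andP[G0 GEi]]].
have nF : F i != 0 by apply: contraTneq F0 => ->; rewrite /deg size_poly0.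
have nG : G i != 0 by apply: contraTneq G0 => ->; rewrite /deg size_poly0.
have := height_boxtimes_root_le R nF nG (leq_trans F0 FDi) (leq_trans G0 GEi) FDi GEi.
have hpos p n : p != 0 -> 0 < (height p)%:R `^ n :> R.
  by move=> p0; rewrite powR_gt0 // ltr0n height_gt0.
have := hpos _ (D i)%:R^-1 nF; have := hpos _ (E i)%:R^-1 nG.
have := hpos _ (D i * E i)%:R^-1 (boxtimes_neq0 R nF nG).
rewrite !powRN; set HF := (height (F i))%:R `^ _; set HG := (height (G i))%:R `^ _.
set HB := _ `^ (D i * E i)%:R^-1 => HB0 HG0 HF0 le.
rewrite -[X in _ < X -> _]div1r -[X in _ -> _ < X -> _]div1r -[X in _ -> _ -> _ < X]div1r.
rewrite !ltr_pdivlMr // mul1r => l1 l2.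
have : 8 * C * x i * HF * (y i * HG) < 1.
  rewrite -[ltRHS]mul1r ltr_pM // ?mulr_ge0 // ltW //.
apply: le_lt_trans.
have -> : 8 * C * x i * HF * (y i * HG) = C * (x i * y i) * (8 * (HF * HG)) by ring.
by rewrite ler_wpM2l // !mulr_ge0 // ltW.
Qed.

Lemma Zgrow_boxtimes (theta eta : R) (d e : star U nat) (mu nu : PR U R)
    (f g : star U {poly int}) :
  sle (sconst U 1%N) d -> sle (sconst U 1%N) e -> PReps mu -> PReps nu ->
  Zgrowdec mu (PRmul (PRpow mu (s1Binvn R e)) nu) e theta d f ->
  Zgrowdec nu (PRmul mu (PRpow nu (s1Binvn R d))) d eta e g ->
  Zgrow (PRmul mu nu) (theta * eta) (smuln d e) (sboxtimes R f g).
Proof.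
move=> d1 e1 [x [x0 _ ->]] [y [y0 _ ->]] {mu nu}.
move: d1 e1 x0 y0; rewrite -(seqcls_repr d) -(seqcls_repr e) -(seqcls_repr f).
rewrite -(seqcls_repr g) -(seqcls_repr x) -(seqcls_repr y).
move: (repr d) (repr e) (repr f) (repr g) (repr x) (repr y) => {d e f g x y} D E F G x y.
move=> /srel_cls D1 /srel_cls E1 /srel_cls x0 /srel_cls y0.
have x0' : npu U [set i | 0 <= x i] by apply: filterS x0 => i /=; exact: ltW.
have y0' : npu U [set i | 0 <= y i] by apply: filterS y0 => i /=; exact: ltW.
move=> [[vF + gF] dF] [[vG + gG] dG].
rewrite /sdeg smap_cls => /srel_cls FD; rewrite smap_cls => /srel_cls GE.
rewrite /sboxtimes smap2_cls.
have [/seqcls_eq F0|nF] := pselect (seqcls U F = sconst U 0).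
  have -> : seqcls U (fun i => boxtimes R (F i) (G i)) = sconst U 0.
    by apply/seqcls_eq; apply: filterS F0 => i /= ->; rewrite /boxtimes eqxx.
  exact: Zgrow0.
have [/seqcls_eq G0|nG] := pselect (seqcls U G = sconst U 0).
  have -> : seqcls U (fun i => boxtimes R (F i) (G i)) = sconst U 0.
    by apply/seqcls_eq; apply: filterS G0 => i /= ->; rewrite /boxtimes eqxx orbT.
  exact: Zgrow0.
have {gF}gF := gF nF; have {gG}gG := gG nG.
move/seqcls_neq0: nF => nF; move/seqcls_neq0: nG => nG.
have dgF : npu U [set i | 0 < deg (F i) <= D i]%N.
  move/Zvan_cls: vF => /(_ 1 ltr01); apply: filterS3 nF FD => i /= Fi FDi Fi1.
  by rewrite (deg_gt0_eval_lt1 Fi Fi1).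
have dgG : npu U [set i | 0 < deg (G i) <= E i]%N.
  move/Zvan_cls: vG => /(_ 1 ltr01); apply: filterS3 nG GE => i /= Gi GEi Gi1.
  by rewrite (deg_gt0_eval_lt1 Gi Gi1).
have [Cf Cf0 {}dF] := decay_le_seq x0 y0 dF.
(* The decay bound for g has its factors in the opposite order; commutativity brings it to the form
   of [decay_le_seq]. *)
have [Cg Cg0 {}dG] : exists2 C, 0 < C & npu U [set i |
    (`|peval (G i) eta| `^ (E i)%:R^-1) `^ (D i)%:R^-1 <= C * (y i `^ (1 - (D i)%:R^-1) * x i)].
  by apply: decay_le_seq => //; rewrite PRmulC.
split.
- apply: (Zvan_boxtimes Cf0 Cg0 x0 y0 dgF dgG _ _ dF dG).
    exact: mahler_growth_infinitesimal gF.
  exact: mahler_growth_infinitesimal gG.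
- rewrite /smuln smap2_cls /sdeg smap_cls; apply/srel_cls.
  apply: filterS3 (filterI nF nG) FD GE => i /= [nFi nGi] FDi GEi.
  by rewrite deg_boxtimes //; exact: leq_mul.
- by move=> _; rewrite PRmul_seq // /smuln smap2_cls; exact: growth_boxtimes_gt.
Qed.

End BoxtimesMap.

Theorem theorem7p3 (R : realType) (U : npultra) (theta eta : R)
    (d e : star U nat)
    (d_ge1 : sle (sconst U 1%N) d) (e_ge1 : sle (sconst U 1%N) e) :
  (forall f g : star U {poly int},
     Zvan theta f -> sle (sdeg f) d -> Zvan eta g -> sle (sdeg g) e ->
     sle (sconst U 1%N) (sdeg f) -> sle (sconst U 1%N) (sdeg g) ->
     PRle (decay (smuln d e) (theta * eta) (sboxtimes R f g))
       (PRadd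
         (PRact (smul (spow (mahlerd R d f) (s1Binvn R e)) (mahlerd R e g))
                (PRpow (decay d theta f) (sinvn R e)))
         (PRact (smul (mahlerd R d f) (spow (mahlerd R e g) (s1Binvn R d)))
                (PRpow (decay e eta g) (sinvn R d)))))
  /\
  (forall mu nu : PR U R, PReps mu -> PReps nu ->
     set_fun
       (Zgrowdec mu (PRmul (PRpow mu (s1Binvn R e)) nu) e theta d `*`
        Zgrowdec nu (PRmul mu (PRpow nu (s1Binvn R d))) d eta e)
       (Zgrow (PRmul mu nu) (theta * eta) (smuln d e))
       (fun fg => sboxtimes R fg.1 fg.2)).
Proof.
split=> [f g _ fd _ ge f1 g1|mu nu mu0 nu0 [f g] /= [Hf Hg]].
  exact: decay_boxtimes_le.
exact: Zgrow_boxtimes Hf Hg.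
Qed.
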